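(* (Stone–Weierstrass theorem for essentially locally compact m-towers.) Let $T$ be an essentially locally compact m-tower and let $E$ be a $*$-subalgebra of $C^*_0(T)$. The uniform closure of $E$ in $C^*_0(T)$ consists of all functions $u\in C^*_0(T)$ such that $$(u(x),u(y))\in\{(v(x),v(y)) : v\in E\}$$ for all $x,y\in\operatorname{core}(T)\setminus T_{(0)}$.
   Context: Conventions. All topological spaces are Hausdorff; $\mathbb N=\{1,2,\ldots\}$. $M_n$ is the $C^*$-algebra of complex $n\times n$ matrices, $\mathcal U_n$ its unitary group, $I_n$ its unit. For $U\in\mathcal U_n$, $X\in M_n$: $U.X=UXU^{-1}$. For $X\in M_n$, $Y\in M_k$, $X\oplus Y\in M_{n+k}$ is the block-diagonal matrix. Towers. A tower is a topological space $T$ with a continuous function $d\colon T\to\mathbb N$, an operation $\oplus\colon T\times T\to T$ and functions $\mathcal U_n\times T_n\ni(U,x)\mapsto U.x\in T$ (where $T_n=d^{-1}(\{n\})$), such that: (T1) $\oplus$ is associative and continuous, and for each $n$ the map $T_n\times T\ni(x,y)\mapsto x\oplus y\in T$ is a closed embedding; (T2) $d(x\oplus y)=d(x)+d(y)$ and $d(U.x)=d(x)$; (T3) each $\mathcal U_n\times T_n\to T_n$ is a continuous group action; (T4) $U.x=x$ if $U\in\mathcal U_{d(x)}$ is a scalar multiple of the unit matrix; (T5) $(U\oplus V).(x\oplus y)=(U.x)\oplus(V.y)$ for $x\in T_n$, $y\in T_k$, $U\in\mathcal U_n$, $V\in\mathcal U_k$; (T6) $U_{d(x),d(y)}.(x\oplus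 y)=y\oplus x$, where $U_{p,q}\in\mathcal U_{p+q}$ is given by $(w_1,\ldots,w_q,z_1,\ldots,z_p)\cdot U_{p,q}=(z_1,\ldots,z_p,w_1,\ldots,w_q)$ (row vectors). Let $T$ be a tower. An element $x$ is reducible if $V.x=a\oplus b$ for some $a,b\in T$, $V\in\mathcal U_{d(x)}$; otherwise it is irreducible. $\operatorname{stab}(x)=\{U\in\mathcal U_{d(x)}: U.x=x\}$. $x\equiv y$ means $U.x=y$ for some $U\in\mathcal U_{d(x)}$; $x\preccurlyeq y$ means that $x\equiv y$ or there are $a,b\in T$ with $x\equiv a$, $y\equiv a\oplus b$; $x\perp y$ ($x,y$ disjoint) means there is no $a\in T$ with $a\preccurlyeq x$ and $a\preccurlyeq y$. $\operatorname{core}(T)$ is the set of irreducible elements and $\overline{\operatorname{core}}(T)$ is its closure in $T$. A topological space $X$ has property $(\sigma)$ if there are sets $K_1\subset K_2\subset\cdots$ with union $X$, each compact Hausdorff in the subspace topology, such that $B\subset X$ is closed iff $B\cap K_n$ is closed for each $n$. An m-tower is a tower $T$ that has property $(\sigma)$ and satisfies for all $x,y,z\in T$: (mT1) if $z\perp x$ and $z\perp y$, then $z\perp x\oplus y$; (mT2) if $z\oplus x\equiv z\oplus y$, then $x\equiv y$; (mT3) if $x\perp y$, then $\operatorname{stab}(x\oplus y)=\{U\oplus V: U\in\operatorname{stab}(x),\ V\in\operatorname{stab}(y)\}$; (mT4) if $x$ is irreducible and $p=d(x)$, then for each $n>0$ the stabilizer of the $n$-fold sum $x\oplus\cdots\oplus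 x$ is $\{I_p\otimes U: U\in\mathcal U_n\}$, where $I_p\otimes[u_{jk}]$ is the block matrix $[u_{jk}I_p]$. $C^*(T)$ is the unital $C^*$-algebra (pointwise operations, supremum norm) of all functions $f$ on $T$ with $f(x)\in M_{d(x)}$, $f|_{T_n}\colon T_n\to M_n$ continuous for all $n$, $f(U.x)=U.f(x)$ for $U\in\mathcal U_{d(x)}$, $f(x\oplus y)=f(x)\oplus f(y)$, and $\|f\|=\sup_{x\in T}\|f(x)\|<\infty$. An m-tower $T$ is essentially locally compact if the space $\overline{\operatorname{core}}(T)$ is locally compact. Then $C^*_0(T)$ is the $*$-subalgebra of all $f\in C^*(T)$ such that for each $\varepsilon>0$ there is a compact $K\subset\overline{\operatorname{core}}(T)$ with $\|f(t)\|\le\varepsilon$ for all $t\in\overline{\operatorname{core}}(T)\setminus K$. The vanishing tower is $T_{(0)}=\{t\in T: f(t)=0 \text{ for all } f\in C^*_0(T)\}$. *)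

(* Defs.v *)
From HB Require Import structures.
From mathcomp Require Import all_boot all_order all_algebra.
From mathcomp Require Import all_classical all_reals all_analysis.
From mathcomp Require Import spectral complex mxtens.

Set Implicit Arguments.
Unset Strict Implicit.
Unset Printing Implicit Defensive.

Import Order.TTheory GRing.Theory Num.Theory.
Import numFieldNormedType.Exports.

Local Open Scope classical_set_scope.
Local Open Scope ring_scope.
Local Open Scope sesquilinear_scope.

(* R[i], packed as a numClosedFieldType so that it receives the topology that
   MathComp-Analysis puts on every such field. *)
Definition Cplx (R : realType) : numClosedFieldType := R[i].

Section Matrices.
Variable R : realType.
Local Notation C := (Cplx R).

Definition l2norm n (v : 'cV[C]_n) : R :=
  Num.sqrt (\sum_(i < n) complex.ComplexField.Normc.normc (v i 0) ^+ 2).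

(* The C*-norm of M_n. *)
Definition opnorm n (X : 'M[C]_n) : R :=
  sup [set l2norm (X *m v) | v in [set v : 'cV[C]_n | l2norm v <= 1]].

Definition swap_mx p q : 'M[C]_(p + q) :=
  castmx (addnC q p, erefl (p + q)%N) (block_mx 0 1%:M 1%:M 0).

Lemma mul_row_swap_mx p q (w : 'rV[C]_q) (z : 'rV[C]_p) :
  castmx (erefl 1%N, addnC q p) (row_mx w z) *m swap_mx p q = row_mx z w.
Proof.
rewrite /swap_mx -[RHS]mulmx1.
have cast_mul m n n' k (e : n = n') (A : 'M[C]_(m, n)) (B : 'M[C]_(n, k)) :
  castmx (erefl m, e) A *m castmx (e, erefl k) B = A *m B.
  by case: _ / e; rewrite !castmx_id.
by rewrite cast_mul mulmx1 mul_row_block !mulmx0 !mulmx1 add0r addr0.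
Qed.

End Matrices.

(* Relatively closed subsets of D are the traces A `&` D with A closed. *)
Definition closed_embedding_on (X Y : topologicalType) (D : set X)
    (f : X -> Y) : Prop :=
  [/\ {within D, continuous f}, {in D &, injective f} &
      forall A : set X, closed A -> closed (f @` (A `&` D))].

(* [act n U x] is U.x for U unitary of size n and [deg x = n]; its values on
   other arguments are unconstrained and never used. *)
Record tower (R : realType) := Tower {
  tower_space :> topologicalType;
  deg : tower_space -> nat;
  oplus : tower_space -> tower_space -> tower_space;
  act : forall n, 'M[Cplx R]_n -> tower_space -> tower_space;
  tower_hausdorff : hausdorff_space tower_space;
  deg_gt0 : forall x, (0 < deg x)%N;
  deg_continuous : continuous deg;
  oplusA : associative oplus;
  oplus_continuous :
    continuous (fun p : tower_space * tower_space => oplus p.1 p.2);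
  oplus_closed_embedding : forall n,
    closed_embedding_on [set p : tower_space * tower_space | deg p.1 = n]
                        (fun p => oplus p.1 p.2);
  deg_oplus : forall x y, deg (oplus x y) = (deg x + deg y)%N;
  deg_act : forall n (U : 'M[Cplx R]_n) x,
    U \is unitarymx -> deg x = n -> deg (act U x) = n;
  act_continuous : forall n,
    {within [set p : 'M[Cplx R]_n * tower_space |
               p.1 \is unitarymx /\ deg p.2 = n],
     continuous (fun p => act p.1 p.2)};
  act1 : forall n x, deg x = n -> act (1%:M : 'M[Cplx R]_n) x = x;
  actM : forall n (U V : 'M[Cplx R]_n) x,
    U \is unitarymx -> V \is unitarymx -> deg x = n ->
    act (U *m V) x = act U (act V x);
  act_scalar : forall n (a : Cplx R) x,
    (a%:M : 'M[Cplx R]_n) \is unitarymx -> deg x = n ->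
    act (a%:M : 'M[Cplx R]_n) x = x;
  act_oplus : forall n k (U : 'M[Cplx R]_n) (V : 'M[Cplx R]_k) x y,
    U \is unitarymx -> V \is unitarymx -> deg x = n -> deg y = k ->
    act (block_mx U 0 0 V) (oplus x y) = oplus (act U x) (act V y);
  act_swap : forall x y,
    act (swap_mx R (deg x) (deg y)) (oplus x y) = oplus y x
}.

Section TowerNotions.
Variables (R : realType) (T : tower R).
Local Notation C := (Cplx R).

Definition reducible (x : T) : Prop :=
  exists a b : T, exists2 V : 'M[C]_(deg x),
    V \is unitarymx & act V x = oplus a b.

Definition irreducible (x : T) : Prop := ~ reducible x.

(* Only meaningful for [n = deg x]; taking n as a parameter avoids casts along
   equations such as [deg_oplus]. *)
Definition stab n (x : T) : set 'M[C]_n :=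
  [set U | U \is unitarymx /\ act U x = x].
Arguments stab : clear implicits.

Definition uequiv (x y : T) : Prop :=
  exists2 U : 'M[C]_(deg x), U \is unitarymx & act U x = y.

Definition subord (x y : T) : Prop :=
  uequiv x y \/ exists a b : T, uequiv x a /\ uequiv y (oplus a b).

Definition udisjoint (x y : T) : Prop := ~ exists a : T, subord a x /\ subord a y.

Definition core : set T := [set x | irreducible x].

(* The n-fold sum of x, for n > 0. *)
Definition nfold n (x : T) : T := iter n.-1 (oplus x) x.

Definition property_sigma (X : topologicalType) : Prop :=
  exists K : nat -> set X,
    [/\ forall n, K n `<=` K n.+1,
        \bigcup_n K n = setT,
        forall n, compact (K n) /\ hausdorff_space (subspace (K n)) &
        forall B : set X, closed B <-> forall n, closed (B `&` K n)].

(* The Kronecker product [A *t B] is the block matrix [A i j *: B], so that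
   I_p (x) U, meant as the block matrix [u_jk I_p], is [U *t 1%:M]. *)
Definition mtower : Prop :=
  [/\ property_sigma T,
      forall x y z : T, udisjoint z x -> udisjoint z y -> udisjoint z (oplus x y),
      forall x y z : T, uequiv (oplus z x) (oplus z y) -> uequiv x y,
      forall x y : T, udisjoint x y ->
        stab (deg x + deg y) (oplus x y) =
        [set M | exists U V, [/\ stab (deg x) x U, stab (deg y) y V &
                                 M = block_mx U 0 0 V]] &
      forall x : T, irreducible x -> forall n, (0 < n)%N ->
        stab (n * deg x) (nfold n x) =
        [set tensmx U (1%:M : 'M[C]_(deg x)) |
           U in [set U : 'M[C]_n | U \is unitarymx]]].

Definition tower_fun := forall x : T, 'M[C]_(deg x).

(* For [deg x = n], [fiber n f x] is f x viewed in M_n. *)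
Definition fiber n (f : tower_fun) (x : T) : 'M[C]_n := conform_mx 0 (f x).

Definition Cstar : set tower_fun := [set f |
  [/\ forall n, {within [set x : T | deg x = n], continuous (@fiber n f)},
      forall (x : T) (U : 'M[C]_(deg x)), U \is unitarymx ->
        fiber (deg x) f (act U x) = U *m f x *m invmx U,
      forall x y : T,
        fiber (deg x + deg y) f (oplus x y) = block_mx (f x) 0 0 (f y) &
      has_ubound (range (fun x : T => opnorm (f x)))]].

Definition Cstar_norm (f : tower_fun) : R := sup (range (fun x : T => opnorm (f x))).

(* The library predicate agrees with local compactness of the subspace
   [closure core] because this set is closed in a Hausdorff space. *)
Definition essentially_locally_compact : Prop := locally_compact (closure core).

Definition Cstar0 : set tower_fun := [set f | Cstar f /\
  forall e : R, 0 < e -> exists K : set T,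
    [/\ compact K, K `<=` closure core &
        forall t, (closure core `\` K) t -> opnorm (f t) <= e]].

Definition vanishing : set T := [set t | forall f, Cstar0 f -> f t = 0].

Definition star_subalgebra (A E : set tower_fun) : Prop :=
  [/\ E `<=` A, E (fun=> 0),
      forall f g, E f -> E g -> E (fun x => f x + g x),
      forall (a : C) f, E f -> E (fun x => a *: f x) &
      (forall f g, E f -> E g -> E (fun x => f x *m g x)) /\
      (forall f, E f -> E (fun x => (f x) ^t*))].

Definition uniform_closure (A E : set tower_fun) : set tower_fun := [set u | A u /\
  forall e : R, 0 < e -> exists2 v, E v & Cstar_norm (fun x => u x - v x) < e].

End TowerNotions.

Arguments stab {R T} n x.
Arguments core {R} T.
Arguments mtower {R} T.
Arguments essentially_locally_compact {R} T.
Arguments Cstar0 {R} T.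
Arguments vanishing {R} T.

(* Main.v *)
(* Every element of a tower decomposes, up to a unitary, into a sum of core
   elements, so norms and values are controlled on the core, and the theorem is a
   Stone-Weierstrass theorem for a *-algebra E of matrix-valued functions whose
   norms are continuous and vanish at infinity on the closure of the core.

   Let u coincide at any two points with an element of E.  By compactness u is
   eps-close to finitely many elements of E, each on its own region, and it
   remains to glue two of them, e on F and f on G, losing nothing in the norm.
   First, E contains an approximate unit for what u and E generate modulo F:
   given k small on F there is 0 <= lam <= 1 in E, small on F, with
   (1 - lam) k small everywhere.  It is built from spectral projections of
   k k^* at a point, which E attains exactly thanks to the two-point
   hypothesis.  Iterating this gives a flag lam_1, lam_2, ... with respect to
   which u - e and u - f are almost tridiagonal; the average lam of the flag
   then almost commutes with both, and e + lam (f - e) is close to u on both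
   F and G.

   Used first with finitely many core points, this extends the two-point
   hypothesis from the core to its closure (finite-dimensional subspaces are
   closed); used again on the closure of the core, it gives the theorem. *)

Require Import Defs.
From HB Require Import structures.
From mathcomp Require Import all_boot all_order all_algebra.
From mathcomp Require Import all_classical all_reals all_analysis.
From mathcomp Require Import spectral complex.
From mathcomp Require Import ring lra zify.

Set Implicit Arguments.
Unset Strict Implicit.
Unset Printing Implicit Defensive.

Import Order.TTheory GRing.Theory Num.Theory.
Import numFieldNormedType.Exports.

Local Open Scope classical_set_scope.
Local Open Scope ring_scope.
Local Open Scope sesquilinear_scope.

(** * The operator norm *)

Section MatrixNorm.
Variable R : realType.
Local Notation C := (Cplx R).
Local Notation normc := (@complex.ComplexField.Normc.normc R).

Definition rc (x : R) : C := (x%:C)%C.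

Definition ip n (v w : 'cV[C]_n) : C := (v^t* *m w) 0 0.

Lemma norm_rc (z : C) : `|z| = rc (normc z).
Proof. by case: z. Qed.

Lemma rcD x y : rc (x + y) = rc x + rc y. Proof. exact: rmorphD. Qed.
Lemma rcM x y : rc (x * y) = rc x * rc y. Proof. exact: rmorphM. Qed.
Lemma rcN x : rc (- x) = - rc x. Proof. exact: rmorphN. Qed.
Lemma rcX x n : rc (x ^+ n) = rc x ^+ n. Proof. exact: rmorphXn. Qed.
Lemma rc0 : rc 0 = 0. Proof. by []. Qed.
Lemma rc1 : rc 1 = 1. Proof. by []. Qed.
Lemma rc_inj : injective rc. Proof. exact: complexI. Qed.
Lemma ler_rc x y : (rc x <= rc y) = (x <= y). Proof. exact: lecR. Qed.
Lemma conj_rc x : (rc x)^* = rc x.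
Proof. exact: conjc_real. Qed.
Lemma normc_rc x : normc (rc x) = `|x|.
Proof. by rewrite /complex.ComplexField.Normc.normc /= expr0n /= addr0 sqrtr_sqr. Qed.

Lemma normc0 : normc (0 : C) = 0.
Proof. by rewrite -[0 in LHS]/(rc 0) normc_rc normr0. Qed.

Lemma normc_ge0 (z : C) : 0 <= normc z.
Proof. by rewrite -ler_rc -norm_rc normr_ge0. Qed.

Lemma normcM (z w : C) : normc (z * w) = normc z * normc w.
Proof. by apply: rc_inj; rewrite rcM -!norm_rc normrM. Qed.

Lemma normcD (z w : C) : normc (z + w) <= normc z + normc w.
Proof. by rewrite -ler_rc rcD -!norm_rc ler_normD. Qed.

Lemma normc_sum I (r : seq I) (P : pred I) (F : I -> C) :
  normc (\sum_(i <- r | P i) F i) <= \sum_(i <- r | P i) normc (F i).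
Proof.
elim/big_ind2: _ => [|x x' y y' le1 le2|//]; first by rewrite normc0.
by apply: le_trans (lerD le1 le2); apply: normcD.
Qed.

Lemma ip_sum n (v w : 'cV[C]_n) : ip v w = \sum_i (v i 0)^* * w i 0.
Proof. by rewrite /ip mxE; apply: eq_bigr => i _; rewrite !mxE. Qed.

Lemma l2norm_sqr n (v : 'cV[C]_n) : rc (l2norm v ^+ 2) = ip v v.
Proof.
rewrite sqr_sqrtr; last by apply: sumr_ge0 => i _; rewrite sqr_ge0.
rewrite ip_sum [LHS]rmorph_sum; apply: eq_bigr => i _.
by rewrite -[LHS]/(rc (normc (v i 0) ^+ 2)) rcX -norm_rc normCK mulrC.
Qed.

Lemma l2norm_ge0 n (v : 'cV[C]_n) : 0 <= l2norm v.
Proof. exact: sqrtr_ge0. Qed.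

Lemma ip_adjoint m n (X : 'M[C]_(m, n)) v w : ip v (X *m w) = ip (X^t* *m v) w.
Proof. by rewrite /ip trmx_mul map_mxM /= trmxCK mulmxA. Qed.

Lemma ipC n (v w : 'cV[C]_n) : ip v w = (ip w v)^*.
Proof.
rewrite !ip_sum rmorph_sum; apply: eq_bigr => i _.
by rewrite rmorphM /= conjCK mulrC.
Qed.

Lemma ipDr n (u v w : 'cV[C]_n) : ip u (v + w) = ip u v + ip u w.
Proof. by rewrite /ip mulmxDr mxE. Qed.
Lemma ipDl n (u v w : 'cV[C]_n) : ip (u + v) w = ip u w + ip v w.
Proof. by rewrite ipC ipDr rmorphD /= -!ipC. Qed.
Lemma ipZr n a (u v : 'cV[C]_n) : ip u (a *: v) = a * ip u v.
Proof. by rewrite /ip -scalemxAr mxE. Qed.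
Lemma ipZl n a (u v : 'cV[C]_n) : ip (a *: u) v = a^* * ip u v.
Proof. by rewrite ipC ipZr rmorphM /= -ipC. Qed.

Lemma ip_cauchy n (v w : 'cV[C]_n) : normc (ip v w) <= l2norm v * l2norm w.
Proof.
have := (CauchySchwarz (@dotmx C n) (v^t*) (w^t*)).1.
rewrite /= !dotmxE !trmxCK -![(_ *m _) 0 0]/(ip _ _) -!l2norm_sqr norm_rc -rcX -rcM ler_rc.
rewrite -exprMn ler_sqr // ?nnegrE ?normc_ge0 //.
by rewrite mulr_ge0 ?l2norm_ge0.
Qed.

Lemma l2normD n (v w : 'cV[C]_n) : l2norm (v + w) <= l2norm v + l2norm w.
Proof.
rewrite -ler_sqr ?nnegrE ?addr_ge0 ?l2norm_ge0 //.
have -> : l2norm (v + w) ^+ 2 = normc (ip (v + w) (v + w)).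
  by rewrite -l2norm_sqr normc_rc ger0_norm // sqr_ge0.
rewrite ipDl !ipDr sqrrD.
apply: le_trans (normcD _ _) _; rewrite -addrA.
have h (u : 'cV[C]_n) : normc (ip u u) = l2norm u ^+ 2.
  by rewrite -l2norm_sqr normc_rc ger0_norm // sqr_ge0.
have h1 := normcD (ip v v) (ip v w); have h2 := normcD (ip w v) (ip w w).
have h3 := ip_cauchy v w; have h4 := ip_cauchy w v.
rewrite !h in h1 h2; move: h1 h2 h3 h4; rewrite [l2norm w * l2norm v]mulrC.
move: (l2norm v ^+ 2) (l2norm w ^+ 2) (l2norm v * l2norm w) (ip v w) (ip w v)
  (ip v v) (ip w w) => a b c s t x y h1 h2 h3 h4.
move: (normc (x + s)) (normc (t + y)) (normc s) (normc t) h1 h2 h3 h4.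
by move=> p q l m h1 h2 h3 h4; rewrite mulr2n; lra.
Qed.

Lemma l2normZ n a (v : 'cV[C]_n) : l2norm (a *: v) = normc a * l2norm v.
Proof.
apply/eqP; rewrite -(@eqrXn2 _ 2) ?mulr_ge0 ?normc_ge0 ?l2norm_ge0 //.
apply/eqP/rc_inj; rewrite l2norm_sqr exprMn rcM l2norm_sqr ipZl ipZr mulrA.
by congr (_ * _); rewrite rcX -norm_rc normCK mulrC.
Qed.

Lemma l2norm0 n : l2norm (0 : 'cV[C]_n) = 0.
Proof. by rewrite -(scale0r 0) l2normZ normc0 mul0r. Qed.

Lemma l2norm_entry n (v : 'cV[C]_n) i : normc (v i 0) <= l2norm v.
Proof.
rewrite -[leLHS]ger0_norm ?normc_ge0 // -sqrtr_sqr ler_wsqrtr // (bigD1 i) //= lerDl.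
by apply: sumr_ge0 => j _; rewrite sqr_ge0.
Qed.

Lemma l2norm_eq0 n (v : 'cV[C]_n) : l2norm v = 0 -> v = 0.
Proof.
move=> v0; apply/matrixP => i j; rewrite ord1 mxE; apply/eqP.
suff /eqP : normc (v i 0) == 0 by move=> h; rewrite -normr_eq0 norm_rc h.
by rewrite eq_le normc_ge0 andbT -v0 l2norm_entry.
Qed.

Lemma l2norm_le_sum n (v : 'cV[C]_n) : l2norm v <= \sum_i normc (v i 0).
Proof.
rewrite -[leRHS]ger0_norm; last by apply: sumr_ge0 => i _; apply: normc_ge0.
rewrite -sqrtr_sqr ler_wsqrtr // expr2 mulr_suml ler_sum // => i _.
rewrite expr2 ler_wpM2l ?normc_ge0 // (bigD1 i) //= lerDl.
by apply: sumr_ge0 => j _; apply: normc_ge0.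
Qed.

(** Crude entrywise bound: it makes the supremum defining [opnorm] finite and later turns entrywise
    continuity into continuity in norm. *)
Lemma mulmx_l2bound m n (X : 'M[C]_(m, n)) v :
  l2norm (X *m v) <= (\sum_i \sum_j normc (X i j)) * l2norm v.
Proof.
apply: le_trans (l2norm_le_sum _) _; rewrite mulr_suml ler_sum // => i _.
rewrite mxE mulr_suml; apply: le_trans (normc_sum _ _ _) _.
by rewrite ler_sum // => j _; rewrite normcM ler_wpM2l ?normc_ge0 ?l2norm_entry.
Qed.

Lemma opnorm_has_sup n (X : 'M[C]_n) :
  has_sup [set l2norm (X *m v) | v in [set v : 'cV[C]_n | l2norm v <= 1]].
Proof.
split; first by exists (l2norm (X *m 0)); exists 0 => //=; rewrite l2norm0 ler01.
exists (\sum_i \sum_j normc (X i j)) => _ [v /= v1 <-].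
apply: le_trans (mulmx_l2bound _ _) _; rewrite -[leRHS]mulr1 ler_wpM2l //.
by apply: sumr_ge0 => i _; apply: sumr_ge0 => j _; apply: normc_ge0.
Qed.

Lemma opnorm_ge0 n (X : 'M[C]_n) : 0 <= opnorm X.
Proof.
apply: sup_upper_bound; first exact: opnorm_has_sup.
by exists 0; rewrite /= ?mulmx0 l2norm0 // ler01.
Qed.

Lemma opnorm_ub n (X : 'M[C]_n) v : l2norm (X *m v) <= opnorm X * l2norm v.
Proof.
have [v0|v_neq0] := eqVneq (l2norm v) 0.
  by rewrite (l2norm_eq0 v0) mulmx0 !l2norm0 mulr0.
have v_gt0 : 0 < l2norm v by rewrite lt0r v_neq0 l2norm_ge0.
rewrite -ler_pdivrMr //.
have -> : l2norm (X *m v) / l2norm v = l2norm (X *m (rc (l2norm v)^-1 *: v)).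
  by rewrite -scalemxAr l2normZ normc_rc ger0_norm ?invr_ge0 ?l2norm_ge0 // mulrC.
apply: sup_upper_bound; first exact: opnorm_has_sup.
exists (rc (l2norm v)^-1 *: v) => //=.
by rewrite l2normZ normc_rc ger0_norm ?invr_ge0 ?l2norm_ge0 // mulVf.
Qed.

Lemma opnorm_le n (X : 'M[C]_n) c : 0 <= c ->
  (forall v, l2norm (X *m v) <= c * l2norm v) -> opnorm X <= c.
Proof.
move=> c0 Xc; apply: ge_sup; first exact: (opnorm_has_sup X).1.
move=> _ [v /= v1 <-]; apply: le_trans (Xc v) _.
by rewrite -[leRHS]mulr1 ler_wpM2l.
Qed.

Lemma opnorm_entry n (X : 'M[C]_n) i j : normc (X i j) <= opnorm X.
Proof.
have := opnorm_ub X (delta_mx j 0).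
have -> : l2norm (delta_mx j 0 : 'cV[C]_n) = 1.
  rewrite /l2norm (bigD1 j) //= big1 => [|k /negbTE kj].
    by rewrite mxE !eqxx normc_rc normr1 expr1n addr0 sqrtr1.
  by rewrite mxE kj; apply: etrans (congr1 (fun x => x ^+ 2) normc0) _; rewrite expr0n.
rewrite mulr1; apply: le_trans; rewrite -colE.
by apply: le_trans (l2norm_entry _ i); rewrite mxE.
Qed.

Lemma opnorm_le_sum n (X : 'M[C]_n) : opnorm X <= \sum_i \sum_j normc (X i j).
Proof.
apply: opnorm_le => [|v]; last exact: mulmx_l2bound.
by apply: sumr_ge0 => i _; apply: sumr_ge0 => j _; apply: normc_ge0.
Qed.

Lemma opnormD n (X Y : 'M[C]_n) : opnorm (X + Y) <= opnorm X + opnorm Y.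
Proof.
apply: opnorm_le => [|v]; first by rewrite addr_ge0 ?opnorm_ge0.
rewrite mulmxDl mulrDl; apply: le_trans (l2normD _ _) _.
by rewrite lerD ?opnorm_ub.
Qed.

Lemma opnormZ n a (X : 'M[C]_n) : opnorm (a *: X) <= normc a * opnorm X.
Proof.
apply: opnorm_le => [|v]; first by rewrite mulr_ge0 ?opnorm_ge0 ?normc_ge0.
by rewrite -scalemxAl l2normZ -mulrA ler_wpM2l ?opnorm_ub ?normc_ge0.
Qed.

Lemma opnorm0 n : opnorm (0 : 'M[C]_n) = 0.
Proof.
apply/eqP; rewrite eq_le opnorm_ge0 andbT.
by apply: opnorm_le => // v; rewrite mul0mx l2norm0 mul0r.
Qed.

Lemma opnormN n (X : 'M[C]_n) : opnorm (- X) = opnorm X.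
Proof.
have h (Y : 'M[C]_n) : opnorm (- Y) <= opnorm Y.
  apply: opnorm_le; first exact: opnorm_ge0.
  move=> v; apply: le_trans (opnorm_ub Y v).
  by rewrite mulNmx -scaleN1r l2normZ -rc1 -rcN normc_rc normrN normr1 mul1r.
apply: le_anti; apply/andP; split; first exact: h X.
rewrite -[X in opnorm X <= _]opprK; exact: h (- X).
Qed.

Lemma opnormB n (X Y : 'M[C]_n) : opnorm (X - Y) <= opnorm X + opnorm Y.
Proof. by rewrite -(opnormN Y) opnormD. Qed.

Lemma opnormM n (X Y : 'M[C]_n) : opnorm (X *m Y) <= opnorm X * opnorm Y.
Proof.
apply: opnorm_le => [|v]; first by rewrite mulr_ge0 ?opnorm_ge0.
rewrite -mulmxA -mulrA; apply: le_trans (opnorm_ub _ _) _.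
by rewrite ler_wpM2l ?opnorm_ge0 ?opnorm_ub.
Qed.

Lemma opnormM_le n (X Y : 'M[C]_n) a b :
  opnorm X <= a -> opnorm Y <= b -> opnorm (X *m Y) <= a * b.
Proof.
by move=> Xa Yb; apply: le_trans (opnormM _ _) _; rewrite ler_pM ?opnorm_ge0.
Qed.

Lemma opnorm_sum n I (r : seq I) (P : pred I) (F : I -> 'M[C]_n) :
  opnorm (\sum_(i <- r | P i) F i) <= \sum_(i <- r | P i) opnorm (F i).
Proof.
elim/big_ind2: _ => [|x x' y y' le1 le2|//]; first by rewrite opnorm0.
by apply: le_trans (lerD le1 le2); apply: opnormD.
Qed.

(** [l2norm (X *m v) ^+ 2] is [ip v (X^t* *m X *m v)], to which Cauchy-Schwarz applies. *)
Lemma opnorm_Cstar n (X : 'M[C]_n) : opnorm X ^+ 2 <= opnorm (X^t* *m X).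
Proof.
have h : opnorm X <= Num.sqrt (opnorm (X^t* *m X)).
  apply: opnorm_le => [|v]; first exact: sqrtr_ge0.
  rewrite -ler_sqr ?nnegrE ?mulr_ge0 ?sqrtr_ge0 ?l2norm_ge0 //.
  rewrite exprMn (sqr_sqrtr (opnorm_ge0 _)).
  have -> : l2norm (X *m v) ^+ 2 = normc (ip v (X^t* *m X *m v)).
    rewrite -mulmxA ip_adjoint trmxCK -l2norm_sqr normc_rc ger0_norm //.
    exact: sqr_ge0.
  apply: le_trans (ip_cauchy _ _) _.
  by rewrite expr2 [leRHS]mulrCA ler_wpM2l ?l2norm_ge0 ?opnorm_ub.
by rewrite -[leRHS]sqr_sqrtr ?opnorm_ge0 // ler_sqr ?nnegrE ?sqrtr_ge0 ?opnorm_ge0.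
Qed.

(** The C*-inequality and submultiplicativity give [|Y|^2 <= |Y^*| |Y|]; cancel [|Y|]. *)
Lemma opnorm_adj n (X : 'M[C]_n) : opnorm (X^t*) = opnorm X.
Proof.
have h (Y : 'M[C]_n) : opnorm Y <= opnorm (Y^t*).
  have := le_trans (opnorm_Cstar Y) (opnormM _ _).
  have := opnorm_ge0 Y; rewrite le_eqVlt => /predU1P[<- _|Y0].
    exact: opnorm_ge0.
  by rewrite expr2 ler_pM2r.
apply: le_anti; apply/andP; split; last exact: h X.
rewrite -[X in _ <= opnorm X]trmxCK; exact: h (X^t*).
Qed.

Lemma opnorm_CstarE n (X : 'M[C]_n) : opnorm (X *m X^t*) = opnorm X ^+ 2.
Proof.
apply/eqP; rewrite eq_le -{1}opnorm_adj.
have := opnorm_Cstar (X^t*); rewrite trmxCK opnorm_adj => ->.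
by rewrite opnorm_adj expr2; have := opnormM X (X^t*); rewrite opnorm_adj => ->.
Qed.

Lemma unitarymx_adj n (U : 'M[C]_n) : U \is unitarymx -> U^t* *m U = 1%:M.
Proof.
by move=> Uu; rewrite -invmx_unitary // mulVmx // unitarymx_unit.
Qed.

Lemma l2norm_unitary n (U : 'M[C]_n) v : U \is unitarymx ->
  l2norm (U *m v) = l2norm v.
Proof.
move=> Uu; apply/eqP; rewrite -(@eqrXn2 _ 2) ?l2norm_ge0 //; apply/eqP/rc_inj.
by rewrite !l2norm_sqr ip_adjoint mulmxA unitarymx_adj // mul1mx.
Qed.

Lemma opnorm_unitary_le n (U : 'M[C]_n) : U \is unitarymx -> opnorm U <= 1.
Proof. by move=> Uu; apply: opnorm_le => // v; rewrite l2norm_unitary // mul1r. Qed.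

Lemma opnorm_conj_unitary_le n (U X : 'M[C]_n) c : U \is unitarymx ->
  opnorm (U *m X *m invmx U) <= c -> opnorm X <= c.
Proof.
move=> Uu Xc.
have -> : X = invmx U *m (U *m X *m invmx U) *m U.
  by rewrite -!mulmxA mulVmx ?mulmx1 ?mulKmx ?unitarymx_unit.
have Ui : invmx U \is unitarymx by rewrite (invmx_unitary Uu) trmxC_unitary.
rewrite -[c]mul1r -[1 * c]mulr1; apply: opnormM_le; last exact: opnorm_unitary_le.
by apply: opnormM_le => //; apply: opnorm_unitary_le.
Qed.

Lemma opnorm_block_le m n (X : 'M[C]_m) (Y : 'M[C]_n) c : 0 <= c ->
  opnorm X <= c -> opnorm Y <= c -> opnorm (block_mx X 0 0 Y) <= c.
Proof.
move=> c0 Xc Yc; apply: opnorm_le => // v.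
rewrite -ler_sqr ?nnegrE ?mulr_ge0 ?l2norm_ge0 // exprMn.
have col_sqr (a : 'cV[C]_m) (b : 'cV[C]_n) :
    l2norm (col_mx a b) ^+ 2 = l2norm a ^+ 2 + l2norm b ^+ 2.
  rewrite !sqr_sqrtr; try by apply: sumr_ge0 => i _; rewrite sqr_ge0.
  rewrite big_split_ord /=; congr (_ + _); apply: eq_bigr => i _;
  by rewrite (col_mxEu, col_mxEd).
rewrite -[v]vsubmxK mul_block_col !mul0mx addr0 add0r !col_sqr mulrDr.
have le (p : nat) (Z : 'M[C]_p) w : opnorm Z <= c ->
    l2norm (Z *m w) ^+ 2 <= c ^+ 2 * l2norm w ^+ 2.
  move=> Zc; rewrite -exprMn ler_sqr ?nnegrE ?mulr_ge0 ?l2norm_ge0 //.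
  by apply: le_trans (opnorm_ub _ _) _; rewrite ler_wpM2r ?l2norm_ge0.
by rewrite lerD // le.
Qed.

End MatrixNorm.

(** * Functional calculus for hermitian matrices *)

Section SpectralCalculus.
Variable R : realType.
Local Notation C := (Cplx R).
Local Notation normc := (@complex.ComplexField.Normc.normc R).
Local Notation Re := (@complex.Re R).

Definition herm n (H : 'M[C]_n) : Prop := H^t* = H.

Lemma adjM m n p (X : 'M[C]_(m, n)) (Y : 'M[C]_(n, p)) :
  (X *m Y)^t* = Y^t* *m X^t*.
Proof. by rewrite trmx_mul map_mxM. Qed.
Lemma adjD n (X Y : 'M[C]_n) : (X + Y)^t* = X^t* + Y^t*.
Proof. by rewrite linearD /= map_mxD. Qed.
Lemma adjN n (X : 'M[C]_n) : (- X)^t* = - X^t*.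
Proof. by rewrite linearN /= map_mxN. Qed.
Lemma adjZ n a (X : 'M[C]_n) : (a *: X)^t* = a^* *: X^t*.
Proof. by rewrite linearZ /= map_mxZ. Qed.
Lemma adj1 n : (1%:M : 'M[C]_n)^t* = 1%:M.
Proof. by rewrite trmx1 map_mx1. Qed.
Lemma adj0 n : (0 : 'M[C]_n)^t* = 0.
Proof. by rewrite trmx0 map_mx0. Qed.

Lemma hermMadj n (X : 'M[C]_n) : herm (X *m X^t*).
Proof. by rewrite /herm adjM trmxCK. Qed.

Lemma hermD n (X Y : 'M[C]_n) : herm X -> herm Y -> herm (X + Y).
Proof. by rewrite /herm adjD => -> ->. Qed.

Lemma hermZ n a (X : 'M[C]_n) : herm X -> herm (rc a *: X).
Proof. by rewrite /herm adjZ conj_rc => ->. Qed.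

Lemma herm0 n : herm (0 : 'M[C]_n).
Proof. exact: adj0. Qed.

Definition udiag n (P : 'M[C]_n) (d : 'rV[C]_n) : 'M[C]_n :=
  P^t* *m diag_mx d *m P.

(* The real functional calculus; meaningful for hermitian H only. *)
Definition mfun (phi : R -> R) n (H : 'M[C]_n) : 'M[C]_n :=
  udiag (spectralmx H) (map_mx (fun z : C => rc (phi (Re z))) (spectral_diag H)).

Definition spec n (H : 'M[C]_n) : set R :=
  [set t | exists2 v : 'cV[C]_n, v != 0 & H *m v = rc t *: v].

Lemma spectralmxK n (H : 'M[C]_n) : (spectralmx H)^t* *m spectralmx H = 1%:M.
Proof. by rewrite unitarymx_adj // spectral_unitarymx. Qed.

Lemma spectralmxKV n (H : 'M[C]_n) : spectralmx H *m (spectralmx H)^t* = 1%:M.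
Proof. exact/unitarymxP/spectral_unitarymx. Qed.

Lemma herm_hermsymmx n (H : 'M[C]_n) : herm H -> H \is hermsymmx.
Proof. by move=> hH; apply/is_hermitianmxP; rewrite expr0 scale1r -[LHS]hH. Qed.

Lemma spectral_diag_rc n (H : 'M[C]_n) i : herm H ->
  spectral_diag H 0 i = rc (Re (spectral_diag H 0 i)).
Proof.
move=> /herm_hermsymmx /hermitian_spectral_diag_real /mxOverP /(_ 0 i) h.
by rewrite /rc (RRe_real h).
Qed.

Lemma mfun_id n (H : 'M[C]_n) : herm H -> mfun id H = H.
Proof.
move=> hH; have hn := hermitian_normalmx (herm_hermsymmx hH).
have e : udiag (spectralmx H) (spectral_diag H) = H.
  by rewrite /udiag -invmx_unitary ?spectral_unitarymx //; apply/esym/orthomx_spectralP.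
rewrite -[RHS]e; congr udiag; apply/matrixP => i j.
by rewrite ord1 mxE -spectral_diag_rc.
Qed.

Lemma mfunD phi psi n (H : 'M[C]_n) :
  mfun (fun t => phi t + psi t) H = mfun phi H + mfun psi H.
Proof.
rewrite {2 3}/mfun /udiag -mulmxDl -mulmxDr -linearD; congr udiag.
by apply/matrixP => i j; rewrite !mxE rcD.
Qed.

Lemma mfunZ c phi n (H : 'M[C]_n) :
  mfun (fun t => c * phi t) H = rc c *: mfun phi H.
Proof.
rewrite {2}/mfun /udiag scalemxAl scalemxAr -linearZ; congr udiag.
by apply/matrixP => i j; rewrite !mxE rcM.
Qed.

Lemma mfunM phi psi n (H : 'M[C]_n) :
  mfun (fun t => phi t * psi t) H = mfun phi H *m mfun psi H.
Proof.
rewrite {2 3}/mfun; set d1 := map_mx _ _; set d2 := map_mx _ _.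
have -> : udiag (spectralmx H) d1 *m udiag (spectralmx H) d2 =
    udiag (spectralmx H) (\row_j (d1 0 j * d2 0 j)).
  rewrite /udiag -[diag_mx (\row_j _)]mulmx_diag !mulmxA.
  by rewrite -(mulmxA _ (spectralmx H)) spectralmxKV mulmx1.
by congr udiag; apply/matrixP => i j; rewrite !mxE rcM ord1.
Qed.

Lemma mfun_cst c n (H : 'M[C]_n) : mfun (fun=> c) H = (rc c)%:M.
Proof.
rewrite /mfun /udiag (_ : diag_mx _ = (rc c)%:M); last first.
  by apply/matrixP => i j; rewrite !mxE.
by rewrite mul_mx_scalar -scalemxAl spectralmxK scalemx1.
Qed.

Lemma mfun_herm phi n (H : 'M[C]_n) : herm (mfun phi H).
Proof.
rewrite /herm {1}/mfun /udiag !adjM trmxCK mulmxA tr_diag_mx map_diag_mx.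
congr udiag; apply/matrixP => i j; rewrite !mxE; exact: conj_rc.
Qed.

Lemma mfun_eigen phi n (H : 'M[C]_n) i :
  mfun phi H *m ((spectralmx H)^t* *m (delta_mx i 0 : 'cV[C]_n)) =
  rc (phi (Re (spectral_diag H 0 i))) *: ((spectralmx H)^t* *m (delta_mx i 0 : 'cV[C]_n)).
Proof.
rewrite /mfun /udiag -!mulmxA (mulmxA (spectralmx H)) spectralmxKV mul1mx scalemxAr.
congr (_ *m _); apply/matrixP => a b; rewrite ord1 mul_diag_mx !mxE andbT.
by case: eqP => [->|_] //; rewrite !mulr0.
Qed.

Lemma spectral_col_neq0 n (H : 'M[C]_n) i :
  (spectralmx H)^t* *m (delta_mx i 0 : 'cV[C]_n) != 0.
Proof.
apply/eqP => /(congr1 (mulmx (spectralmx H))).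
rewrite mulmxA spectralmxKV mul1mx mulmx0 => /matrixP /(_ i 0).
by rewrite !mxE !eqxx => /eqP; rewrite oner_eq0.
Qed.

Lemma spec_diag n (H : 'M[C]_n) i : herm H -> spec H (Re (spectral_diag H 0 i)).
Proof.
move=> hH; exists ((spectralmx H)^t* *m (delta_mx i 0 : 'cV[C]_n)).
  exact: spectral_col_neq0.
by rewrite -[X in X *m _](mfun_id hH) mfun_eigen.
Qed.

Lemma mfun_ext phi psi n (H : 'M[C]_n) : herm H ->
  (forall t, spec H t -> phi t = psi t) -> mfun phi H = mfun psi H.
Proof.
move=> hH e; congr udiag.
by apply/matrixP => i j; rewrite !mxE ord1 e //; apply: spec_diag.
Qed.

Lemma diag_opnorm_le n (d : 'rV[C]_n) c : 0 <= c ->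
  (forall i, normc (d 0 i) <= c) -> opnorm (diag_mx d) <= c.
Proof.
move=> c0 dc; apply: opnorm_le => // v.
rewrite -[c]ger0_norm // -sqrtr_sqr -sqrtrM ?sqr_ge0 // ler_wsqrtr //.
rewrite mulr_sumr ler_sum // => i _.
by rewrite mul_diag_mx mxE normcM exprMn ler_wpM2r ?sqr_ge0 // lerXn2r ?nnegrE ?normc_ge0.
Qed.

Lemma mfun_opnorm phi n (H : 'M[C]_n) c : herm H -> 0 <= c ->
  (forall t, spec H t -> `|phi t| <= c) -> opnorm (mfun phi H) <= c.
Proof.
move=> hH c0 phic; rewrite -[c]mulr1 -[c * 1]mul1r mulrA.
apply: opnormM_le; last by rewrite opnorm_unitary_le ?spectral_unitarymx.
apply: opnormM_le.
  by rewrite opnorm_adj opnorm_unitary_le ?spectral_unitarymx.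
apply: diag_opnorm_le => // i; rewrite mxE normc_rc.
exact/phic/spec_diag.
Qed.

Lemma col_neq0 n (v : 'cV[C]_n) : v != 0 -> exists i, v i 0 != 0.
Proof.
move=> /eqP v0; apply: contrapT => h; apply: v0; apply/matrixP => i j.
by rewrite ord1 mxE; apply: contrapT => /eqP vi; apply: h; exists i.
Qed.

(** In the basis of [spectralmx H] the matrix [mfun phi H] is diagonal, and any nonzero coordinate
    of an eigenvector singles out its eigenvalue. *)
Lemma spec_mfun_diag phi n (H : 'M[C]_n) t : herm H ->
  spec (mfun phi H) t -> exists i, t = phi (Re (spectral_diag H 0 i)).
Proof.
move=> hH [v v0 vt].
pose w := spectralmx H *m v.
have w0 : w != 0.
  apply/eqP => /(congr1 (mulmx ((spectralmx H)^t*))).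
  by rewrite mulmxA spectralmxK mul1mx mulmx0 => /eqP; apply/negP.
have [i wi] := col_neq0 w0.
exists i; move: vt => /(congr1 (mulmx (spectralmx H))).
rewrite /mfun /udiag -!mulmxA mulmxA spectralmxKV mul1mx -scalemxAr -/w.
move=> /matrixP /(_ i 0).
by rewrite mul_diag_mx [RHS]mxE [LHS]mxE [X in X * _]mxE => /(mulIf wi) /rc_inj.
Qed.

Lemma spec_mfun phi n (H : 'M[C]_n) t : herm H ->
  spec (mfun phi H) t -> exists2 s, spec H s & t = phi s.
Proof.
move=> hH /(spec_mfun_diag hH)[i ->].
by exists (Re (spectral_diag H 0 i)) => //; apply: spec_diag.
Qed.

Lemma spec_finite n (H : 'M[C]_n) : herm H ->
  exists s : seq R, forall t, spec H t -> t \in s.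
Proof.
move=> hH; exists [seq Re (spectral_diag H 0 i) | i <- enum 'I_n] => t.
rewrite -{1}(mfun_id hH) => /(spec_mfun_diag hH)[i ->].
by apply: map_f; rewrite mem_enum.
Qed.

Lemma spec_opnorm n (H : 'M[C]_n) t : spec H t -> `|t| <= opnorm H.
Proof.
move=> [v v0 vt]; have v_gt0 : 0 < l2norm v.
  rewrite lt0r l2norm_ge0 andbT; apply: contra v0 => /eqP v0.
  by apply/eqP/l2norm_eq0.
by rewrite -(ler_pM2r v_gt0) -normc_rc -l2normZ -vt opnorm_ub.
Qed.

(** * Positive matrices and positive contractions *)

Definition psd n (H : 'M[C]_n) : Prop := herm H /\ forall v, 0 <= ip v (H *m v).

Lemma spec_psd n (H : 'M[C]_n) t : psd H -> spec H t -> 0 <= t.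
Proof.
move=> [_ Hp] [v v0 vt].
have v_gt0 : 0 < l2norm v.
  rewrite lt0r l2norm_ge0 andbT; apply: contra v0 => /eqP v0.
  by apply/eqP/l2norm_eq0.
have := Hp v; rewrite vt ipZr -l2norm_sqr -rcM -rc0 ler_rc.
by rewrite pmulr_lge0 // exprn_gt0.
Qed.

Lemma psdMadj n (X : 'M[C]_n) : psd (X *m X^t*).
Proof.
split=> [|v]; first exact: hermMadj.
by rewrite -mulmxA ip_adjoint -l2norm_sqr -rc0 ler_rc sqr_ge0.
Qed.

Lemma psdD n (X Y : 'M[C]_n) : psd X -> psd Y -> psd (X + Y).
Proof.
move=> [hX X0] [hY Y0]; split=> [|v]; first exact: hermD.
by rewrite mulmxDl ipDr addr_ge0.
Qed.

Lemma psd0 n : psd (0 : 'M[C]_n).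
Proof. by split=> [|v]; [exact: herm0|rewrite mul0mx /ip mulmx0 mxE]. Qed.

Lemma psdZ n a (X : 'M[C]_n) : 0 <= a -> psd X -> psd (rc a *: X).
Proof.
move=> a0 [hX X0]; split=> [|v]; first exact: hermZ.
by rewrite -scalemxAl ipZr mulr_ge0 // -rc0 ler_rc.
Qed.

Lemma psd_sum n I (r : seq I) (P : pred I) (F : I -> 'M[C]_n) :
  (forall i, P i -> psd (F i)) -> psd (\sum_(i <- r | P i) F i).
Proof. exact: (big_ind (@psd n) (@psd0 n) (@psdD n)). Qed.

(** Positive contractions, [0 <= A <= 1], described by the spectrum so that calculus with functions
    from [0,1] to [0,1] visibly preserves them. *)
Definition pcon n (A : 'M[C]_n) : Prop :=
  herm A /\ forall t, spec A t -> 0 <= t <= 1.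

Lemma psd_pcon n (A : 'M[C]_n) : psd A -> opnorm A <= 1 -> pcon A.
Proof.
move=> Ap A1; split=> [|t tA]; first exact: Ap.1.
rewrite (spec_psd Ap tA) /=; apply: le_trans A1.
by apply: le_trans (spec_opnorm tA); apply: ler_norm.
Qed.

Lemma mfun_pcon phi n (H : 'M[C]_n) : herm H ->
  (forall t, spec H t -> 0 <= phi t <= 1) -> pcon (mfun phi H).
Proof.
move=> hH h; split=> [|t]; first exact: mfun_herm.
by case/(spec_mfun hH) => s sH ->; apply: h.
Qed.

Lemma mfun_pcon_opnorm phi n (A : 'M[C]_n) c : pcon A -> 0 <= c ->
  (forall t, 0 <= t <= 1 -> `|phi t| <= c) -> opnorm (mfun phi A) <= c.
Proof. by move=> [hA A01] c0 h; apply: mfun_opnorm => // t /A01 /h. Qed.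

Lemma pcon_opnorm n (A : 'M[C]_n) : pcon A -> opnorm A <= 1.
Proof.
move=> Ap; rewrite -(mfun_id Ap.1); apply: mfun_pcon_opnorm => // t /andP[t0 t1].
by rewrite ger0_norm.
Qed.

Lemma mfun_1sub phi n (A : 'M[C]_n) : mfun (fun t => 1 - phi t) A = 1%:M - mfun phi A.
Proof.
have -> : (fun t => 1 - phi t) = (fun t => 1 + (-1) * phi t).
  by apply/funext => t; rewrite mulN1r.
by rewrite mfunD mfun_cst mfunZ rcN rc1 scaleN1r.
Qed.

Lemma pcon_1sub_opnorm n (A : 'M[C]_n) : pcon A -> opnorm (1%:M - A) <= 1.
Proof.
move=> Ap; rewrite -{1}(mfun_id Ap.1) -mfun_1sub.
by apply: mfun_pcon_opnorm => // t /andP[t0 t1]; rewrite ger0_norm; lra.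
Qed.

Lemma ip_herm n (X : 'M[C]_n) v w : herm X -> ip v (X *m w) = ip (X *m v) w.
Proof. by move=> hX; rewrite ip_adjoint hX. Qed.

Lemma ip_herm_sqr n (X : 'M[C]_n) v : herm X ->
  ip v (X *m X *m v) = rc (l2norm (X *m v) ^+ 2).
Proof. by move=> hX; rewrite -mulmxA ip_adjoint hX l2norm_sqr. Qed.

(** The column with blocks [A] and [1 - A] is a contraction, because [t^2 + (1 - t)^2 <= 1] on
    [0,1]. *)
Lemma pcon_row n (A : 'M[C]_n) v : pcon A ->
  l2norm (A *m v) ^+ 2 + l2norm ((1%:M - A) *m v) ^+ 2 <= l2norm v ^+ 2.
Proof.
move=> Ap.
have e1 : 1%:M - A = mfun (fun t => 1 - t) A by rewrite mfun_1sub (mfun_id Ap.1).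
have hA := Ap.1; have hA1 : herm (1%:M - A) by rewrite e1; apply: mfun_herm.
have -> : l2norm (A *m v) ^+ 2 + l2norm ((1%:M - A) *m v) ^+ 2 =
    normc (ip v (mfun (fun t => t * t + (1 - t) * (1 - t)) A *m v)).
  apply: rc_inj; rewrite mfunD !(mfunM _ _ A) (mfun_id hA) -e1.
  rewrite [X in ip _ X]mulmxDl ipDr !ip_herm_sqr // -rcD normc_rc ger0_norm //.
  by rewrite addr_ge0 ?sqr_ge0.
apply: le_trans (ip_cauchy _ _) _; rewrite expr2 ler_wpM2l ?l2norm_ge0 //.
apply: le_trans (opnorm_ub _ _) _; rewrite -[leRHS]mul1r ler_wpM2r ?l2norm_ge0 //.
apply: mfun_pcon_opnorm => // t /andP[t0 t1].
rewrite ger0_norm; nra.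
Qed.

(** With [V] the contractive column of [pcon_row], the matrix is [V^* diag(X, Y) V]: weights [A] and
    [1 - A] placed on both sides cost nothing in the norm. *)
Lemma pcon_compress n (A X Y : 'M[C]_n) c : 0 <= c -> pcon A ->
  opnorm X <= c -> opnorm Y <= c ->
  opnorm (A *m X *m A + (1%:M - A) *m Y *m (1%:M - A)) <= c.
Proof.
move=> c0 Ap Xc Yc; set B := 1%:M - A; set Z := _ + _.
have hB : herm B by rewrite /herm /B adjD adj1 adjN Ap.1.
have ipZ v w : normc (ip v (Z *m w)) <= c * (l2norm v * l2norm w).
  have -> : ip v (Z *m w) = ip (A *m v) (X *m (A *m w)) + ip (B *m v) (Y *m (B *m w)).
    by rewrite /Z mulmxDl ipDr -!mulmxA (ip_herm v _ Ap.1) (ip_herm v _ hB).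
  apply: le_trans (normcD _ _) _.
  have le (V : 'M[C]_n) a b : opnorm V <= c ->
      normc (ip a (V *m b)) <= c * (l2norm a * l2norm b).
    move=> Vc; apply: le_trans (ip_cauchy _ _) _; rewrite mulrCA.
    rewrite ler_wpM2l ?l2norm_ge0 //; apply: le_trans (opnorm_ub _ _) _.
    by rewrite ler_wpM2r ?l2norm_ge0.
  apply: le_trans (lerD (le _ _ _ Xc) (le _ _ _ Yc)) _.
  rewrite -mulrDr ler_wpM2l //.
  have := pcon_row v Ap; have := pcon_row w Ap; rewrite -/B.
  have := l2norm_ge0 (A *m v); have := l2norm_ge0 (B *m v).
  have := l2norm_ge0 (A *m w); have := l2norm_ge0 (B *m w).
  have := l2norm_ge0 v; have := l2norm_ge0 w.
  move: (l2norm _) (l2norm _) (l2norm (A *m w)) (l2norm (B *m w))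
    (l2norm (A *m v)) (l2norm (B *m v)) => y x a b d e y0 x0 b0 a0 e0 d0 h1 h2.
  rewrite -ler_sqr ?nnegrE ?addr_ge0 ?mulr_ge0 //.
  (* Lagrange's identity gives the Cauchy-Schwarz inequality for the plane vectors [(d, e)] and
     [(a, b)]. *)
  apply: (@le_trans _ _ ((d ^+ 2 + e ^+ 2) * (a ^+ 2 + b ^+ 2))).
    have -> : (d ^+ 2 + e ^+ 2) * (a ^+ 2 + b ^+ 2) =
      (d * a + e * b) ^+ 2 + (d * b - e * a) ^+ 2 by ring.
    by rewrite lerDl sqr_ge0.
  by rewrite exprMn mulrC [leRHS]mulrC ler_pM // addr_ge0 ?sqr_ge0.
apply: opnorm_le => // v.
have [z0|z_neq0] := eqVneq (l2norm (Z *m v)) 0.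
  by rewrite z0 mulr_ge0 ?l2norm_ge0.
have z_gt0 : 0 < l2norm (Z *m v) by rewrite lt0r z_neq0 l2norm_ge0.
have := ipZ (Z *m v) v; rewrite -l2norm_sqr normc_rc ger0_norm ?sqr_ge0 //.
by rewrite expr2 mulrCA ler_pM2l.
Qed.

(* Monotonicity of the norm: X a_j a_j^* X^* <= X A X^* for A = \sum_i a_i a_i^*. *)
Lemma opnorm_mulmx_sum n m (X : 'M[C]_n) (a : 'I_m -> 'M[C]_n) j :
  opnorm (X *m a j) ^+ 2 <= opnorm (X *m (\sum_i a i *m (a i)^t*) *m X^t*).
Proof.
set A := \sum_i _; have Xa0 := opnorm_ge0 (X *m A *m X^t*).
rewrite -opnorm_adj adjM -[leRHS]sqr_sqrtr //.
rewrite lerXn2r ?nnegrE ?opnorm_ge0 ?sqrtr_ge0 //.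
apply: opnorm_le => [|v]; first exact: sqrtr_ge0.
rewrite -ler_sqr ?nnegrE ?mulr_ge0 ?sqrtr_ge0 ?l2norm_ge0 // exprMn (sqr_sqrtr Xa0).
apply: (@le_trans _ _ (\sum_i l2norm ((a i)^t* *m X^t* *m v) ^+ 2)).
  by rewrite (bigD1 j) //= lerDl; apply: sumr_ge0 => i _; apply: sqr_ge0.
have -> : \sum_i l2norm ((a i)^t* *m X^t* *m v) ^+ 2 = normc (ip v (X *m A *m X^t* *m v)).
  apply: rc_inj; rewrite -norm_rc ger0_norm; last first.
    have -> : X *m A *m X^t* = \sum_i (X *m a i) *m (X *m a i)^t*.
      rewrite /A mulmx_sumr mulmx_suml; apply: eq_bigr => i _.
      by rewrite adjM !mulmxA.
    by have [_] : psd (\sum_i (X *m a i) *m (X *m a i)^t*)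
      by apply: psd_sum => i _; apply: psdMadj.
  have -> : rc (\sum_i l2norm ((a i)^t* *m X^t* *m v) ^+ 2) =
      \sum_i rc (l2norm ((a i)^t* *m X^t* *m v) ^+ 2) by apply: rmorph_sum.
  have -> : X *m A *m X^t* *m v = \sum_i (X *m a i) *m ((X *m a i)^t* *m v).
    rewrite /A mulmx_sumr !mulmx_suml; apply: eq_bigr => i _.
    by rewrite adjM !mulmxA.
  rewrite /ip mulmx_sumr summxE; apply: eq_bigr => i _.
  by rewrite l2norm_sqr -[RHS]/(ip _ _) [RHS]ip_adjoint adjM.
apply: le_trans (ip_cauchy _ _) _.
by rewrite expr2 [leRHS]mulrCA ler_wpM2l ?l2norm_ge0 ?opnorm_ub.
Qed.

End SpectralCalculus.

(** * Auxiliary real polynomials *)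

Section ScalarPolynomials.
Variable R : realType.

Lemma poly_interpolation (s : seq R) (c : R -> R) :
  exists q : {poly R}, forall t, t \in s -> q.[t] = c t.
Proof.
elim: s => [|a s [q qs]]; first by exists 0.
have [a_s|a_s] := boolP (a \in s).
  by exists q => t; rewrite inE => /predU1P[->|]; apply: qs.
pose w : {poly R} := \prod_(b <- s) ('X - b%:P).
have wa : w.[a] != 0 by rewrite -/(root w a) root_prod_XsubC.
exists (q + ((c a - q.[a]) / w.[a]) *: w) => t; rewrite inE hornerD hornerZ.
have [-> _|_ /= ts] := eqVneq t a; first by rewrite divfK // addrC subrK.
have /rootP -> : root w t by rewrite root_prod_XsubC.
by rewrite mulr0 addr0 qs.
Qed.

(* On [0, N + 1] the polynomial t ((N + 1 - t) / N)^N is maximal at t = 1,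
   where its value is 1. *)
Lemma clamp_le1 N (z : R) : 0 <= z ->
  z ^+ N * (N.+1%:R - N%:R * z) <= 1.
Proof.
move=> z0; elim: N => [|N]; first by rewrite mul0r subr0 mulr1 expr0.
apply: le_trans; rewrite -subr_ge0 exprS.
have -> : z ^+ N * (N.+1%:R - N%:R * z) - z * z ^+ N * (N.+2%:R - N.+1%:R * z)
    = N.+1%:R * z ^+ N * (1 - z) ^+ 2.
  by rewrite -!natr1; ring.
by apply: mulr_ge0 (sqr_ge0 _); rewrite mulr_ge0 ?exprn_ge0 ?ler0n.
Qed.

(** An interpolating [q] takes the values 0 and 1 on the nodes. Applying to [q^2] the polynomial of
    [clamp_le1], which fixes 0 and 1 and maps [0, N + 1] into [0, 1], bounds it on all of [0, L]
    without moving those values. *)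
Lemma step_poly (s : seq R) (d L : R) : 0 <= d ->
  exists p : {poly R}, [/\ p.[0] = 0,
    forall t, 0 <= t <= L -> 0 <= p.[t] <= 1 &
    forall t, t \in s -> p.[t] = (d < t)%R%:R].
Proof.
move=> d0.
have [q qs] := poly_interpolation (0 :: s) (fun t => (d < t)%R%:R).
have [M qM] := poly_itv_bound q 0 L.
pose N := (Num.truncn (M ^+ 2)).+1.
have MN : M ^+ 2 <= N.+1%:R.
  rewrite ltW //; apply: lt_trans (truncnS_gt _) _; rewrite ltr_nat.
  by rewrite /N.
have N0 : (N%:R : R) != 0 by rewrite pnatr_eq0.
pose p := q ^+ 2 * (N%:R^-1 *: (N.+1%:R%:P - q ^+ 2)) ^+ N.
have pE t : p.[t] = q.[t] ^+ 2 * (N%:R^-1 * (N.+1%:R - q.[t] ^+ 2)) ^+ N.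
  by rewrite /p hornerM !horner_exp hornerZ hornerD hornerN hornerC !horner_exp.
have p01 (b : bool) t : q.[t] = b%:R -> p.[t] = b%:R.
  move=> e; rewrite pE e; case: b {e}; last by rewrite expr0n mul0r.
  by rewrite expr1n mul1r -natr1 addrK mulVf // expr1n.
exists p; split=> [|t tL|t ts].
- by apply: (p01 false); rewrite qs ?mem_head // ltNge d0.
- rewrite pE; set z := N%:R^-1 * _.
  have qt2 : q.[t] ^+ 2 <= N.+1%:R.
    apply: le_trans MN; rewrite -real_normK ?num_real //.
    have := qM t tL; have := normr_ge0 q.[t].
    move: `|_| => x x0 xM; rewrite ler_sqr ?nnegrE //; exact: le_trans xM.
  have z0 : 0 <= z by rewrite mulr_ge0 ?invr_ge0 ?ler0n // subr_ge0.
  have -> : q.[t] ^+ 2 = N.+1%:R - N%:R * z by rewrite /z mulVKf // subKr.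
  rewrite [_ * z ^+ N]mulrC clamp_le1 // andbT mulr_ge0 ?exprn_ge0 //.
  by rewrite /z mulVKf // subKr sqr_ge0.
- by apply: p01; rewrite qs // inE ts orbT.
Qed.

(** By induction [(1 - y)^k (1 + k y) <= 1], and [(k + 1) y <= 1 + k y]. *)
Lemma mul_expn_le k (y : R) : 0 <= y <= 1 -> y * (1 - y) ^+ k <= k.+1%:R^-1.
Proof.
move=> /andP[y0 y1].
have h : (1 - y) ^+ k * (1 + k%:R * y) <= 1.
  elim: k => [|k]; first by rewrite mul0r addr0 mulr1 expr0.
  apply: le_trans; rewrite exprS -mulrA mulrCA ler_wpM2l ?exprn_ge0 ?subr_ge0 //.
  rewrite -natr1; have : (0 : R) <= k%:R by rewrite ler0n.
  by move: (k%:R) => x x0; nra.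
rewrite -[leRHS]mul1r ler_pdivlMr ?ltr0n //; apply: le_trans h.
rewrite mulrAC mulrC ler_wpM2l ?exprn_ge0 ?subr_ge0 //.
by rewrite -natr1 mulrDr mulr1 addrC mulrC lerD2r.
Qed.

Lemma bernoulli n (t : R) : 0 <= t <= 1 -> 1 - (1 - t) ^+ n <= n%:R * t.
Proof.
move=> /andP[t0 t1]; elim: n => [|n IH]; first by rewrite mul0r expr0 subrr.
have : 0 <= (1 - t) ^+ n <= 1.
  by rewrite exprn_ge0 ?subr_ge0 //= exprn_ile1 ?subr_ge0 //; lra.
move: IH; rewrite exprS -natr1; move: (_ ^+ n) => u IH /andP[u0 u1].
by have : 0 <= t * (1 - u) by [rewrite mulr_ge0 ?subr_ge0]; nra.
Qed.

(* Newton-type iteration for the square root of v ^+ 2. *)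
Fixpoint abs_poly k : {poly R} :=
  if k is k'.+1 then abs_poly k' + 2^-1 *: ('X^2 - abs_poly k' ^+ 2) else 0.

(** With [a = |v|], one step multiplies the error [a - p] by [1 - (a + p) / 2 <= 1 - a / 2]; then
    [mul_expn_le] at [a / 2] gives a rate uniform in [v]. *)
Lemma abs_polyP k (v : R) : `|v| <= 1 ->
  0 <= (abs_poly k).[v] /\ 0 <= `|v| - (abs_poly k).[v] <= 2 / k.+1%:R.
Proof.
move=> v1; pose a := `|v|; have a0 : 0 <= a by apply: normr_ge0.
suff h : 0 <= (abs_poly k).[v] /\
    0 <= a - (abs_poly k).[v] <= a * (1 - a / 2) ^+ k.
  case: h => h0 /andP[h1 h2]; split => //; rewrite h1; apply: le_trans h2 _.
  have /(@mul_expn_le k) : 0 <= a / 2 <= 1 by apply/andP; split; rewrite /a in a0 *; lra.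
  move=> h3; have -> : a * (1 - a / 2) ^+ k = 2 * (a / 2 * (1 - a / 2) ^+ k) by field.
  by rewrite ler_pM2l.
elim: k => [|k [IH0 /andP[IH1 IH2]]] /=.
  by rewrite horner0 expr0 mulr1 subr0 lexx a0.
rewrite hornerD hornerZ hornerD hornerN hornerXn horner_exp.
have -> : v ^+ 2 = a ^+ 2 by rewrite real_normK // num_real.
move: (abs_poly k).[v] IH0 IH1 IH2 => p p0 p1 p2.
have {}v1 : a <= 1 by [].
have -> : a - (p + 2^-1 * (a ^+ 2 - p ^+ 2)) = (a - p) * (1 - (a + p) / 2) by field.
split; first by have : 0 <= (a - p) * (a + p) by [nra]; nra.
rewrite mulr_ge0 //=; last by lra.
rewrite exprS [leRHS]mulrCA [leRHS]mulrC; apply: ler_pM => //; lra.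
Qed.

(** The ramp is [(|l| + l) / 2] with [l = 2 t - 1]. It kills [0, 1/2] and fixes 1; exactness at 0
    keeps the calculus inside an algebra without unit, exactness at 1 preserves projections. *)
Lemma ramp_poly (e : R) : 0 < e ->
  exists p : {poly R}, [/\ p.[0] = 0, p.[1] = 1 &
    forall t : R, 0 <= t <= 1 -> `|p.[t] - Num.max 0 (2 * t - 1)| <= e].
Proof.
move=> e0; pose k := Num.truncn (4 / e); pose q := abs_poly k.
have ke : 2 / k.+1%:R <= e / 2.
  rewrite ler_pdivrMr ?ltr0n // mulrAC ler_pdivlMr //.
  have := truncnS_gt (4 / e); rewrite ltr_pdivrMr // -/k => h.
  by rewrite [leRHS]mulrC; lra.
pose l : {poly R} := 2 *: 'X - 1.
pose r := 2^-1 *: ((q \Po l) + l).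
have lE t : l.[t] = 2 * t - 1 by rewrite /l hornerD hornerN hornerZ hornerX hornerC.
have rE t : r.[t] = 2^-1 * (q.[2 * t - 1] + (2 * t - 1)).
  by rewrite /r hornerZ hornerD horner_comp !lE.
have rP (t : R) : 0 <= t <= 1 ->
    Num.max 0 (2 * t - 1) - e / 4 <= r.[t] <= Num.max 0 (2 * t - 1).
  move=> /andP[t0 t1]; rewrite rE.
  have v1 : `|2 * t - 1| <= 1 by rewrite ler_norml; apply/andP; split; lra.
  have [_ /andP[q1 q2]] := abs_polyP k v1; rewrite -/q in q1 q2.
  move: (q.[_]) (2 / k.+1%:R : R) q1 q2 ke => x y q1 q2 ke.
  case: (leP 0 (2 * t - 1)) => h.
    by rewrite ger0_norm // in q1 q2; apply/andP; split; lra.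
  by rewrite ltr0_norm // in q1 q2; apply/andP; split; lra.
have /andP[r0l r0u] := rP 0 (introT andP (conj (lexx 0) ler01)).
have /andP[r1l r1u] := rP 1 (introT andP (conj ler01 (lexx 1))).
have m0 : Num.max 0 (2 * 0 - 1) = 0 :> R by rewrite max_l //; lra.
have m1 : Num.max 0 (2 * 1 - 1) = 1 :> R by rewrite max_r //; lra.
rewrite m0 in r0l r0u; rewrite m1 in r1l r1u.
clear rE; clearbody r.
(* Subtracting the affine interpolant of the errors at 0 and 1 restores the end values and costs at
   most [e / 4] for each end. *)
exists (r - r.[0] *: (1 - 'X) - (r.[1] - 1) *: 'X); split.
- by rewrite !(hornerD, hornerN, hornerZ, hornerX, hornerC); ring.
- by rewrite !(hornerD, hornerN, hornerZ, hornerX, hornerC); ring.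
- move=> t t01; have /andP[h1 h2] := rP t t01; case/andP: t01 => t0 t1.
  rewrite !(hornerD, hornerN, hornerZ, hornerX, hornerC).
  move: (r.[0]) (r.[1]) (r.[t]) (Num.max 0 (2 * t - 1) : R) r0l r0u r1l r1u h1 h2 => a b c m *.
  have h : 0 <= - (a * (1 - t)) <= e / 4 by apply/andP; split; nra.
  have h' : 0 <= - ((b - 1) * t) <= e / 4 by apply/andP; split; nra.
  by case/andP: h h' => ? ? /andP[? ?]; rewrite ler_norml; apply/andP; split; lra.
Qed.

End ScalarPolynomials.

(** * Almost orthogonality along a flag *)

Section GlueEstimate.
Variable R : realType.
Local Notation C := (Cplx R).

(** In the product of the adjoint sum with the sum, the [N] diagonal terms are at most [M^2] and the
    others, at most [N^2] in number, at most [k]; for small [k] the norm grows like [sqrt N] instead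
    of [N]. *)
Lemma almost_orthogonal_sum n N (D : nat -> 'M[C]_n) M k :
  0 <= M -> 0 <= k ->
  (forall i, opnorm (D i) <= M) ->
  (forall i j, (i < j < N)%N -> opnorm ((D i)^t* *m D j) <= k) ->
  opnorm (\sum_(i < N) D i) ^+ 2 <= N%:R * M ^+ 2 + N%:R ^+ 2 * k.
Proof.
move=> M0 k0 DM Dk; apply: le_trans (opnorm_Cstar _) _.
have -> : (\sum_(i < N) D i)^t* = \sum_(i < N) (D i)^t*.
  elim/big_ind2: _ => [|x x' y y' <- <-|//]; [exact: adj0|exact: adjD].
rewrite mulmx_suml; apply: le_trans (opnorm_sum _ _ _) _.
apply: (@le_trans _ _ (\sum_(i < N) (M ^+ 2 + N%:R * k))); last first.
  rewrite sumr_const card_ord -[leLHS]mulr_natl mulrDr [N%:R ^+ 2]expr2 mulrA.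
  exact: lexx.
apply: ler_sum => i _; rewrite mulmx_sumr; apply: le_trans (opnorm_sum _ _ _) _.
apply: (@le_trans _ _ (\sum_(j < N) ((if j == i then M ^+ 2 else 0) + k))).
  apply: ler_sum => j _; case: eqVneq => [->|ji].
    rewrite -[leLHS]addr0 lerD // expr2 opnormM_le // opnorm_adj //.
  rewrite add0r; case: (ltngtP i j) => [ij|ij|/val_inj ij].
  - by rewrite Dk // ij ltn_ord.
  - by rewrite -opnorm_adj adjM trmxCK Dk // ij ltn_ord.
  - by rewrite ij eqxx in ji.
rewrite big_split /= -big_mkcond big_pred1_eq sumr_const card_ord -[k *+ _]mulr_natl.
exact: lexx.
Qed.

Lemma sub1mxM n (A X : 'M[C]_n) : X - A *m X = (1%:M - A) *m X.
Proof. by rewrite mulmxBl mul1mx. Qed.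

Variables (n : nat) (L : nat -> 'M[C]_n) (c1 c2 : 'M[C]_n) (r M : R).
Hypotheses (r0 : 0 <= r) (M0 : 0 <= M).
Hypothesis Lp : forall j, pcon (L j).
(** Each [L j.+1] is, up to [r], a left unit for [L j]. The hypotheses [Lc1] and [Lc2] below say the
    same for [c1 *m L j] and [c2^t* *m L j], so [c1] and [c2^t*] almost raise the flag by at most
    one level. *)
Hypothesis LL : forall j, opnorm ((1%:M - L j.+1) *m L j) <= r.

(** Inserting [L a + (1 - L a)] with [a = i + j + 1] before [L i] costs one more [r] per level. *)
Lemma flag_far_le i j : opnorm ((1%:M - L (i + j.+1)) *m L i) <= j.+1%:R * r.
Proof.
elim: j => [|j IH]; first by rewrite addn1 mul1r.
rewrite addnS; set a := (i + j.+1)%N in IH *.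
have -> : (1%:M - L a.+1) *m L i = (1%:M - L a.+1) *m L a *m L i
    + (1%:M - L a.+1) *m ((1%:M - L a) *m L i).
  by rewrite -mulmxA -mulmxDr -mulmxDl addrCA subrr addr0 mul1mx.
have -> : j.+2%:R * r = r * 1 + 1 * (j.+1%:R * r).
  by rewrite -[j.+2%:R]natr1 mulrDl mul1r addrC mulr1 mul1r.
apply: le_trans (opnormD _ _) _; apply: lerD; apply: opnormM_le => //.
  exact: pcon_opnorm.
exact: pcon_1sub_opnorm.
Qed.

Hypotheses (c1M : opnorm c1 <= M) (c2M : opnorm c2 <= M).
Hypothesis Lc1 : forall j, opnorm ((1%:M - L j.+1) *m (c1 *m L j)) <= r.
Hypothesis Lc2 : forall j, opnorm ((1%:M - L j.+1) *m (c2^t* *m L j)) <= r.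

(** The off-diagonal remainder: [L j *m c2 + (1 - L j) *m c1] minus the part [L j *m c2 *m L j + (1
    - L j) *m c1 *m (1 - L j)] that [pcon_compress] bounds without loss. *)
Let D j := L j *m c2 *m (1%:M - L j) + (1%:M - L j) *m c1 *m L j.

Let DM j : opnorm (D j) <= 2 * M.
Proof.
have L1 := pcon_opnorm (Lp j); have L1' := pcon_1sub_opnorm (Lp j).
have h1 := opnormM_le (opnormM_le L1 c2M) L1'.
have h2 := opnormM_le (opnormM_le L1' c1M) L1.
have -> : 2 * M = 1 * M * 1 + 1 * M * 1 by ring.
exact: le_trans (opnormD _ _) (lerD h1 h2).
Qed.

Let LL_adj j : opnorm (L j *m (1%:M - L j.+1)) <= r.
Proof.
rewrite -opnorm_adj adjM (Lp j).1 adjD adj1 adjN (Lp j.+1).1; exact: LL.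
Qed.

(** The range of [D j] lies almost under [L j.+1], while by [D_below] the matrix [L j] almost
    annihilates [D j.+1]. The [D j] thus sit in layers, and layers at least two apart are almost
    orthogonal ([D_orth]). *)
Let D_above j : opnorm ((1%:M - L j.+1) *m D j) <= r * (1 + 2 * M).
Proof.
have L1 := pcon_opnorm (Lp j); have L1' := pcon_1sub_opnorm (Lp j).
have -> : (1%:M - L j.+1) *m D j =
   (1%:M - L j.+1) *m L j *m c2 *m (1%:M - L j)
   + ((1%:M - L j.+1) *m (c1 *m L j) - (1%:M - L j.+1) *m L j *m c1 *m L j).
  rewrite /D mulmxDr !mulmxA; congr (_ + _).
  by rewrite -!mulmxA -mulmxBr (mulmxBl _ _ (c1 *m L j)) mul1mx.
apply: le_trans (opnormD _ _) _.
apply: le_trans (lerD (lexx _) (opnormB _ _)) _.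
have h1 : opnorm ((1%:M - L j.+1) *m L j *m c2 *m (1%:M - L j)) <= r * M * 1.
  exact: opnormM_le (opnormM_le (LL j) c2M) L1'.
have h2 : opnorm ((1%:M - L j.+1) *m L j *m c1 *m L j) <= r * M * 1.
  exact: opnormM_le (opnormM_le (LL j) c1M) L1.
have -> : r * (1 + 2 * M) = r * M * 1 + (r + r * M * 1) by ring.
by apply: lerD h1 (lerD (Lc1 j) h2).
Qed.

Let D_below j : opnorm (L j *m D j.+1) <= r * (1 + 2 * M).
Proof.
have L1 := pcon_opnorm (Lp j.+1); have L1' := pcon_1sub_opnorm (Lp j.+1).
have -> : L j *m D j.+1 =
   (L j *m c2 *m (1%:M - L j.+1) - L j *m (1%:M - L j.+1) *m c2 *m (1%:M - L j.+1))
   + L j *m (1%:M - L j.+1) *m c1 *m L j.+1.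
  rewrite /D mulmxDr !mulmxA; congr (_ + _).
  have -> : L j *m L j.+1 = L j - L j *m (1%:M - L j.+1).
    by rewrite mulmxBr mulmx1 opprB addrC subrK.
  by rewrite !mulmxBl.
apply: le_trans (opnormD _ _) _.
apply: le_trans (lerD (opnormB _ _) (lexx _)) _.
(* The adjoint of this product is controlled by [Lc2], which is why that hypothesis concerns
   [c2^t*]. *)
have h0 : opnorm (L j *m c2 *m (1%:M - L j.+1)) <= r.
  rewrite -opnorm_adj !adjM (Lp j).1 adjD adj1 adjN (Lp j.+1).1; exact: Lc2.
have h1 : opnorm (L j *m (1%:M - L j.+1) *m c2 *m (1%:M - L j.+1)) <= r * M * 1.
  exact: opnormM_le (opnormM_le (LL_adj j) c2M) L1'.
have h2 : opnorm (L j *m (1%:M - L j.+1) *m c1 *m L j.+1) <= r * M * 1.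
  exact: opnormM_le (opnormM_le (LL_adj j) c1M) L1.
have -> : r * (1 + 2 * M) = (r + r * M * 1) + r * M * 1 by ring.
by apply: lerD (lerD h0 h1) h2.
Qed.

Let D_far_below i j : opnorm (L i *m D (i + j.+1)) <= r * (1 + 2 * M) * j.+1%:R.
Proof.
elim: j i => [|j IH] i; first by rewrite addn1 mulr1; exact: D_below.
have -> : L i *m D (i + j.+2) = L i *m (1%:M - L i.+1) *m D (i + j.+2)
    + L i *m (L i.+1 *m D (i.+1 + j.+1)).
  by rewrite addSnnS mulmxA -mulmxDl -mulmxDr subrK mulmx1.
have h1 := opnormM_le (LL_adj i) (DM (i + j.+2)).
have h2 := opnormM_le (pcon_opnorm (Lp i)) (IH i.+1).
apply: le_trans (opnormD _ _) _; apply: le_trans (lerD h1 h2) _.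
have -> : r * (1 + 2 * M) * j.+2%:R =
    r * (1 + 2 * M) + 1 * (r * (1 + 2 * M) * j.+1%:R).
  by rewrite -[j.+2%:R]natr1; ring.
by rewrite lerD2r ler_wpM2l // lerDr ler01.
Qed.

(** Insert [L i.+1 + (1 - L i.+1)] between the factors: the complement is small on [D i], and
    [L i.+1] is small on [D j]. *)
Let D_orth i j : (i.+2 <= j)%N ->
  opnorm ((D i)^t* *m D j) <= r * (1 + 2 * M) * (2 * M) * j.+1%:R.
Proof.
move=> ij.
have -> : (D i)^t* *m D j = ((1%:M - L i.+1) *m D i)^t* *m D j
    + (D i)^t* *m (L i.+1 *m D j).
  have e : (1%:M - L i.+1)^t* = 1%:M - L i.+1 by rewrite adjD adj1 adjN (Lp _).1.
  by rewrite adjM e -[X in X + _]mulmxA -mulmxDr -mulmxDl subrK mul1mx.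
apply: le_trans (opnormD _ _) _.
have -> : j = (i.+1 + (j - i.+2).+1)%N by lia.
set k := (j - i.+2)%N.
have adj_le (X : 'M[C]_n) c : opnorm X <= c -> opnorm (X^t*) <= c.
  by rewrite opnorm_adj.
have h1 := opnormM_le (adj_le _ _ (D_above i)) (DM (i.+1 + k.+1)).
have h2 := opnormM_le (adj_le _ _ (DM i)) (D_far_below i.+1 k).
apply: le_trans (lerD h1 h2) _.
set z := r * (1 + 2 * M) * (2 * M).
have z0 : 0 <= z by rewrite /z !mulr_ge0 // addr_ge0 // mulr_ge0.
have -> : 2 * M * (r * (1 + 2 * M) * k.+1%:R) = z * k.+1%:R by rewrite /z; ring.
rewrite -[X in X + _]mulr1 -mulrDr ler_wpM2l // nat1r ler_nat; lia.
Qed.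

(* Averaging over a flag makes it commute with c1 and c2 up to O(1 / sqrt N),
   so the weights 1 - lam and lam glue c1 and c2 without loss in the norm. *)
Lemma flag_average_le N :
  opnorm (\sum_(i < N) ((1%:M - L i.*2.+1) *m c1 + L i.*2.+1 *m c2)) <=
  N%:R * M + Num.sqrt (N%:R * (2 * M) ^+ 2
    + N%:R ^+ 2 * (r * (1 + 2 * M) * (2 * M) * (N.*2)%:R)).
Proof.
set kap := r * _ * _ * _.
have kap0 : 0 <= kap by rewrite /kap !mulr_ge0 // ?ler0n // addr_ge0 // mulr_ge0.
have split_sum i : (1%:M - L i) *m c1 + L i *m c2 =
    (L i *m c2 *m L i + (1%:M - L i) *m c1 *m (1%:M - L i)) + D i.
  have a : L i *m c2 = L i *m c2 *m L i + L i *m c2 *m (1%:M - L i).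
    by rewrite -mulmxDr addrCA subrr addr0 mulmx1.
  have b : (1%:M - L i) *m c1 =
      (1%:M - L i) *m c1 *m (1%:M - L i) + (1%:M - L i) *m c1 *m L i.
    by rewrite -mulmxDr subrK mulmx1.
  rewrite [LHS]addrC; apply: etrans (congr2 +%R a b) _; exact: addrACA.
under eq_bigr => i _ do rewrite split_sum.
rewrite big_split /=; apply: le_trans (opnormD _ _) _; apply: lerD.
  apply: le_trans (opnorm_sum _ _ _) _.
  apply: (@le_trans _ _ (\sum_(i < N) M)).
    by apply: ler_sum => i _; apply: pcon_compress.
  by rewrite sumr_const card_ord mulr_natl; apply: lexx.
rewrite -[leLHS]ger0_norm ?opnorm_ge0 // -sqrtr_sqr ler_wsqrtr //.
have M2 : 0 <= 2 * M by rewrite mulr_ge0.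
(* Distinct odd indices differ by at least two, the gap that [D_orth] asks for. *)
have orth i j : (i < j < N)%N -> opnorm ((D i.*2.+1)^t* *m D j.*2.+1) <= kap.
  move=> /andP[ij jN]; apply: le_trans (D_orth _) _; first by lia.
  rewrite /kap ler_wpM2l ?ler_nat //; last by lia.
  by rewrite !mulr_ge0 // addr_ge0.
exact: (almost_orthogonal_sum M2 kap0 (fun i => DM i.*2.+1) orth).
Qed.

End GlueEstimate.

(** * Algebras of matrix-valued functions *)

Section FunctionAlgebra.
Variables (R : realType) (P : Type) (n : P -> nat).
Local Notation C := (Cplx R).

Definition mxfun := forall p : P, 'M[C]_(n p).

Definition fadd (f g : mxfun) : mxfun := fun p => f p + g p.
Definition fscale (a : C) (f : mxfun) : mxfun := fun p => a *: f p.
Definition fmul (f g : mxfun) : mxfun := fun p => f p *m g p.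
Definition fadj (f : mxfun) : mxfun := fun p => (f p)^t*.

Record star_closed (A : set mxfun) : Prop := StarClosed {
  star0 : A (fun=> 0);
  starD : forall f g, A f -> A g -> A (fadd f g);
  starZ : forall a f, A f -> A (fscale a f);
  starM : forall f g, A f -> A g -> A (fmul f g);
  starJ : forall f, A f -> A (fadj f) }.

Definition fsub (f g : mxfun) : mxfun := fun p => f p - g p.

Lemma starB A f g : star_closed A -> A f -> A g -> A (fsub f g).
Proof.
move=> sA Af Ag; have -> : fsub f g = fadd f (fscale (- 1) g).
  by apply/functional_extensionality_dep => p; rewrite /fsub /fadd /fscale scaleN1r.
by apply: starD => //; apply: starZ.
Qed.

Lemma star_sum A m (F : 'I_m -> mxfun) : star_closed A ->
  (forall i, A (F i)) -> A (fun p => \sum_i F i p).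
Proof.
move=> sA; elim: m F => [|m IH] F AF.
  rewrite (_ : (fun p => _) = (fun=> 0)); first exact: star0.
  by apply/functional_extensionality_dep => p; rewrite big_ord0.
rewrite (_ : (fun p => _) = fadd (F ord0) (fun p => \sum_i F (lift ord0 i) p)).
  by apply: starD => //; apply: IH.
by apply/functional_extensionality_dep => p; rewrite big_ord_recl.
Qed.

(** The algebra need not contain a unit, but the factor [g] absorbs the constant term of [q];
    induction follows Horner's scheme. *)
Lemma star_mfun_mul A (q : {poly R}) f g : star_closed A -> A f ->
  (forall p, herm (f p)) -> A g -> A (fun p => mfun (horner q) (f p) *m g p).
Proof.
move=> sA Af hf; elim/poly_ind: q g => [|q c IH] g Ag.
  rewrite (_ : (fun p => _) = (fun=> 0)); first exact: star0.
  apply/functional_extensionality_dep => p.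
  rewrite (_ : horner 0 = fun=> 0) ?mfun_cst; last by apply/funext => t; rewrite horner0.
  by rewrite rc0 mul_scalar_mx scale0r.
rewrite (_ : (fun p => _) =
  fadd (fun p => mfun (horner q) (f p) *m fmul f g p) (fscale (rc c) g)).
  by apply: (starD sA); [apply: IH; apply: (starM sA)|apply: (starZ sA)].
apply/functional_extensionality_dep => p.
have -> : horner (q * 'X + c%:P) = fun t => q.[t] * t + c.
  by apply/funext => t; rewrite hornerMXaddC.
rewrite mfunD mfun_cst (mfunM (horner q) (fun t => t)).
rewrite (mfun_id (hf p)) mulmxDl mul_scalar_mx /fadd /fmul /fscale.
by rewrite mulmxA.
Qed.

Lemma star_mfun A (q : {poly R}) f : star_closed A -> A f ->
  (forall p, herm (f p)) -> q.[0] = 0 -> A (fun p => mfun (horner q) (f p)).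
Proof.
move=> sA Af hf /eqP /factor_theorem [q' ->].
rewrite subr0 (_ : (fun p => _) = fun p => mfun (horner q') (f p) *m f p).
  exact: star_mfun_mul.
apply/functional_extensionality_dep => p.
have -> : horner (q' * 'X) = fun t => q'.[t] * t.
  by apply/funext => t; rewrite hornerMX.
by rewrite mfunM (mfun_id (hf p)).
Qed.

Definition fbounded (f : mxfun) : Prop :=
  exists2 M, 0 <= M & forall p, opnorm (f p) <= M.

(* Behaves like compactness of the closed set [opnorm (k p) <= d] for open
   covers made of strict sublevel sets of norms. *)
Definition finite_subcovers (W : set mxfun) : Prop :=
  forall (k : mxfun) (d : R) (G : set mxfun) (c : R), W k -> G `<=` W -> 0 < c ->
  (forall p, opnorm (k p) <= d -> exists2 f, G f & opnorm (f p) < c) ->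
  exists m (g : 'I_m -> mxfun), (forall i, G (g i)) /\
    forall p, opnorm (k p) <= d -> exists i, opnorm (g i p) < c.

Variables W E : set mxfun.
Hypotheses (sW : star_closed W) (sE : star_closed E) (EW : E `<=` W).
Hypothesis W_bounded : forall f, W f -> fbounded f.
Hypothesis W_cover : finite_subcovers W.

Definition pairwise_in : set mxfun :=
  [set f | W f /\ forall x y, exists2 v, E v & v x = f x /\ v y = f y].
Local Notation B := pairwise_in.

Lemma pairwise_in_sub : E `<=` B.
Proof. by move=> f Ef; split=> [|x y]; [exact: EW|exists f]. Qed.

Lemma pairwise_in_star : star_closed B.
Proof.
split.
- by split=> [|x y]; [exact: star0|exists (fun=> 0) => //; exact: star0].
- move=> f g [Wf hf] [Wg hg]; split=> [|x y]; first exact: starD.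
  have [v Ev [vx vy]] := hf x y; have [w Ew [wx wy]] := hg x y.
  by exists (fadd v w); [exact: starD|rewrite /fadd vx vy wx wy].
- move=> a f [Wf hf]; split=> [|x y]; first exact: starZ.
  have [v Ev [vx vy]] := hf x y.
  by exists (fscale a v); [exact: starZ|rewrite /fscale vx vy].
- move=> f g [Wf hf] [Wg hg]; split=> [|x y]; first exact: starM.
  have [v Ev [vx vy]] := hf x y; have [w Ew [wx wy]] := hg x y.
  by exists (fmul v w); [exact: starM|rewrite /fmul vx vy wx wy].
- move=> f [Wf hf]; split=> [|x y]; first exact: starJ.
  have [v Ev [vx vy]] := hf x y.
  by exists (fadj v); [exact: starJ|rewrite /fadj vx vy].
Qed.

(** * Separating a point from a sublevel set *)

Section ApproximateUnit.
Variables (k : mxfun) (d : R).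
Hypotheses (Bk : B k) (d0 : 0 <= d).

(** The projection onto the left singular vectors of [k y] with singular value above [d]. *)
Let top_proj y : 'M[C]_(n y) :=
  mfun (fun t => (d ^+ 2 < t)%R%:R) (k y *m (k y)^t*).

Let top_projM y : top_proj y *m top_proj y = top_proj y.
Proof.
rewrite /top_proj -mfunM; apply: mfun_ext (hermMadj _) _ => t _.
by case: ltP; rewrite ?mulr1 ?mulr0.
Qed.

(** The square of the norm is the norm of [(1 - P) k k^* (1 - P)], a function of [k k^*] with values
    at most [d^2]. *)
Lemma top_proj_opnorm y : opnorm (k y - top_proj y *m k y) <= d.
Proof.
have hk := hermMadj (k y).
rewrite sub1mxM; set X := 1%:M - _.
have eX : X = mfun (fun t => 1 - (d ^+ 2 < t)%R%:R) (k y *m (k y)^t*).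
  by rewrite mfun_1sub.
have hX : herm X by rewrite eX; apply: mfun_herm.
rewrite -ler_sqr ?nnegrE ?opnorm_ge0 // -opnorm_CstarE adjM hX.
have -> : X *m k y *m ((k y)^t* *m X) =
    mfun (fun t => (1 - (d ^+ 2 < t)%R%:R) * t * (1 - (d ^+ 2 < t)%R%:R)) (k y *m (k y)^t*).
  by rewrite !mfunM -eX (mfun_id hk) !mulmxA.
apply: mfun_opnorm => //; first exact: sqr_ge0.
move=> t tk; have t0 := spec_psd (psdMadj _) tk.
case: ltP => [_|td]; first by rewrite subrr !mul0r normr0 sqr_ge0.
by rewrite subr0 mulr1 mul1r ger0_norm.
Qed.

(** Take [e] in [E] with the values of [k] at both points. The spectra of [e e^*] there are finite,
    so a single step polynomial reproduces the spectral projection exactly at [y]; at [x] it gives 0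
    when the spectrum lies in [[0, d^2]]. *)
Lemma separate_points x y : exists2 a, E a & [/\ forall p, pcon (a p),
  a y = top_proj y & opnorm (k x) <= d -> a x = 0].
Proof.
have [e Ee [ex ey]] := Bk.2 x y.
pose h := fmul e (fadj e).
have Eh : E h by apply: starM => //; apply: starJ.
have hh p : herm (h p) by apply: hermMadj.
have [M _ hM] := W_bounded (EW Eh).
have hspec p t : spec (h p) t -> 0 <= t <= M.
  move=> st; rewrite (spec_psd (psdMadj _) st) /=.
  exact: le_trans (ler_norm _) (le_trans (spec_opnorm st) (hM p)).
have [s1 s1P] := spec_finite (hh x); have [s2 s2P] := spec_finite (hh y).
have [q [q0 q01 qs]] := step_poly (s1 ++ s2) M (sqr_ge0 d).
exists (fun p => mfun (horner q) (h p)).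
  exact: star_mfun.
split=> [p||kx].
- by apply: mfun_pcon => // t /hspec /q01.
- rewrite /top_proj (_ : k y *m (k y)^t* = h y); last by rewrite /h /fmul /fadj ey.
  by apply: mfun_ext => // t /s2P ts; rewrite qs // mem_cat ts orbT.
- rewrite (@mfun_ext _ _ (fun=> 0)) ?mfun_cst ?rc0 ?raddf0 //.
  move=> t st; rewrite qs ?mem_cat ?s1P //.
  have := le_trans (ler_norm _) (spec_opnorm st).
  rewrite /h /fmul /fadj ex opnorm_CstarE => tk.
  rewrite ltNge (le_trans tk) // ler_sqr ?nnegrE ?opnorm_ge0 //.
Qed.

(** By compactness finitely many elements from [separate_points] suffice, one of them small at each
    point where [k] is small. All equal the same projection at [y], so their product [a] does too,
    and [a a^*] restores positivity. *)
Lemma separate_set y : exists2 b, E b & [/\ forall p, pcon (b p),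
  forall q : {poly R}, q.[0] = 0 -> q.[1] = 1 -> mfun (horner q) (b y) = b y,
  opnorm (k y - b y *m k y) <= d &
  forall p, opnorm (k p) <= d -> opnorm (b p) <= 2^-1].
Proof.
pose G : set mxfun := [set a | [/\ E a, forall p, pcon (a p) & a y = top_proj y]].
have [||x kx|m [g [gG gcov]]] := W_cover (k := k) (d := d) (G := G) (c := 2^-1) Bk.1.
- by move=> a [/EW].
- by rewrite invr_gt0.
- have [a Ea [ap ay ax]] := separate_points x y.
  by exists a => //; rewrite ax // opnorm0 invr_gt0.
have [a [Ea a1 ay ak]] : exists a, [/\ E a, forall p, opnorm (a p) <= 1,
    a y = top_proj y & forall p, (exists i, opnorm (g i p) < 2^-1) ->
      opnorm (a p) <= 2^-1].
  elim: m g gG {gcov} => [|m IH] g gG.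
    (* Without any factor the smallness clause is void, but the value at [y] still has to be
       right. *)
    have [a Ea [ap ay _]] := separate_points y y.
    exists a; split; [exact: Ea|by move=> p; apply: pcon_opnorm|exact: ay|].
    move=> p [i _].
    apply: False_ind; exact: notF (ltn_ord i).
  have [a [Ea a1 ay ak]] := IH (fun i => g (lift ord0 i)) (fun i => gG _).
  have [Eg gp gy] := gG ord0.
  exists (fmul (g ord0) a); split.
  - exact: starM.
  - by move=> p; rewrite -[1]mulr1; apply: opnormM_le => //; apply: pcon_opnorm.
  - by rewrite /fmul gy ay top_projM.
  - move=> p; case=> i; case: (unliftP ord0 i) => [j ->|->] gip.
      rewrite -[2^-1]mul1r; apply: opnormM_le; first exact: pcon_opnorm.
      by apply: ak; exists j.
    by rewrite -[2^-1]mulr1; apply: opnormM_le => //; apply: ltW.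
have b_proj : fmul a (fadj a) y = top_proj y.
  by rewrite /fmul /fadj ay mfun_herm top_projM.
exists (fmul a (fadj a)); first by apply: starM => //; apply: starJ.
split=> [p|q q0 q1||p kp].
- apply: psd_pcon; first exact: psdMadj.
  by rewrite opnorm_CstarE expr_le1 ?opnorm_ge0.
- have hb := mfun_herm (fun t => (d ^+ 2 < t)%R%:R) (k y *m (k y)^t*).
  rewrite b_proj -[RHS](mfun_id hb); apply: mfun_ext hb _ => t.
  case/(spec_mfun (hermMadj _)) => u _ ->.
  by case: (d ^+ 2 < u).
- by rewrite b_proj; apply: top_proj_opnorm.
- have ap := ak p (gcov p kp).
  by rewrite -[2^-1]mul1r; apply: opnormM_le (a1 p) _; rewrite opnorm_adj.
Qed.

End ApproximateUnit.
End FunctionAlgebra.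

(** * Approximate units *)

Section Density.
Variables (R : realType) (P : Type) (n : P -> nat).
Local Notation C := (Cplx R).
Local Notation mxfun := (mxfun R n).
Variables W E : set mxfun.
Hypotheses (sW : star_closed W) (sE : star_closed E) (EW : E `<=` W).
Hypothesis W_bounded : forall f, W f -> fbounded f.
Hypothesis W_cover : finite_subcovers W.
Local Notation B := (pairwise_in W E).

Lemma ramp_opnorm m (b : 'M[C]_m) (q : {poly R}) e : pcon b -> 0 <= e ->
  opnorm b <= 2^-1 ->
  (forall t : R, 0 <= t <= 1 -> `|q.[t] - Num.max 0 (2 * t - 1)| <= e) ->
  opnorm (mfun (horner q) b) <= e.
Proof.
move=> bp e0 b2 qe; apply: mfun_opnorm => //; first exact: bp.1.
move=> t st; have t01 := bp.2 t st.
have t2 := le_trans (le_trans (ler_norm t) (spec_opnorm st)) b2.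
have := qe t t01; rewrite max_l ?subr0 // subr_le0.
by rewrite -ler_pdivlMl // mulr1.
Qed.

Lemma ramp_dist_opnorm m (b : 'M[C]_m) (q q' : {poly R}) e e' : pcon b ->
  0 <= e -> 0 <= e' ->
  (forall t : R, 0 <= t <= 1 -> `|q.[t] - Num.max 0 (2 * t - 1)| <= e) ->
  (forall t : R, 0 <= t <= 1 -> `|q'.[t] - Num.max 0 (2 * t - 1)| <= e') ->
  opnorm (mfun (horner q) b - mfun (horner q') b) <= e + e'.
Proof.
move=> bp e0 e'0 qe q'e.
have -> : mfun (horner q) b - mfun (horner q') b =
    mfun (fun t => q.[t] + (-1) * q'.[t]) b.
  by rewrite mfunD mfunZ rcN rc1 scaleN1r.
apply: (mfun_pcon_opnorm bp); first exact: addr_ge0.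
move=> t t01; have h1 := qe t t01; have h2 := q'e t t01; rewrite mulN1r.
have -> : q.[t] - q'.[t] = (q.[t] - Num.max 0 (2 * t - 1)) -
  (q'.[t] - Num.max 0 (2 * t - 1)) by ring.
exact: le_trans (ler_normB _ _) (lerD h1 h2).
Qed.

Lemma ramp_bound m (b : 'M[C]_m) (q : {poly R}) e : pcon b -> 0 <= e <= 1 ->
  (forall t : R, 0 <= t <= 1 -> `|q.[t] - Num.max 0 (2 * t - 1)| <= e) ->
  opnorm (mfun (horner q) b) <= 2.
Proof.
move=> bp /andP[e0 e1] qe; apply: mfun_pcon_opnorm => // t t01.
have h := qe t t01; case/andP: t01 => t0 t1.
have h2 : `|Num.max 0 (2 * t - 1)| <= 1.
  rewrite ger0_norm ?le_max ?lexx // ge_max ler01 /= lerBlDr.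
  by rewrite -[X in _ <= X]mulr1 ler_pM2l.
have := ler_normD (q.[t] - Num.max 0 (2 * t - 1)) (Num.max 0 (2 * t - 1)).
rewrite subrK => h3; apply: le_trans h3 _; apply: le_trans (lerD h h2) _.
by rewrite -[2]/(1 + 1) lerD2r.
Qed.

Section Averages.
Variables (m l : nat) (s : 'I_l -> 'M[C]_m) (N : nat).
Hypothesis s2 : forall i, opnorm (s i) <= 2.

(** Normalised for [average_pcon]: each [s i *m (s i)^t*] has norm at most 4, and [l.+1] keeps the
    divisor nonzero when [l = 0]. *)
Let A := rc (4 * l.+1%:R)^-1 *: \sum_i s i *m (s i)^t*.

Let c0 : 0 <= (4 * l.+1%:R)^-1 :> R.
Proof. by rewrite invr_ge0 mulr_ge0 ?ler0n. Qed.

Lemma average_opnorm_le e : 0 <= e -> (forall i, opnorm (s i) <= e) ->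
  opnorm A <= 4^-1 * e ^+ 2.
Proof.
move=> e0 se; apply: le_trans (opnormZ _ _) _; rewrite normc_rc (ger0_norm c0).
have h : opnorm (\sum_i s i *m (s i)^t*) <= l.+1%:R * e ^+ 2.
  apply: le_trans (opnorm_sum _ _ _) _.
  apply: (@le_trans _ _ (\sum_(i < l) e ^+ 2)).
    apply: ler_sum => i _; rewrite opnorm_CstarE lerXn2r ?nnegrE ?opnorm_ge0 //.
  rewrite sumr_const card_ord -[X in X <= _]mulr_natl ler_wpM2r ?sqr_ge0 //.
  by rewrite ler_nat.
apply: le_trans (ler_wpM2l c0 h) _.
by rewrite invfM mulrA mulfVK // pnatr_eq0.
Qed.

Lemma average_pcon : pcon A.
Proof.
apply: psd_pcon.
  by apply: psdZ => //; apply: psd_sum => i _; apply: psdMadj.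
apply: le_trans (average_opnorm_le (ler0n R 2) s2) _.
by rewrite expr2 -natrM mulVf // pnatr_eq0.
Qed.

(** [opnorm_mulmx_sum] reduces this to [X A X] for [X = (1 - A)^N], a function of [A] with values at
    most [t (1 - t)^N <= 1 / (N + 1)]. *)
Lemma average_complement_opnorm i :
  opnorm (mfun (fun t => (1 - t) ^+ N) A *m s i) ^+ 2 <= 4 * l.+1%:R / N.+1%:R.
Proof.
have Ap := average_pcon.
have hX := mfun_herm (fun t => (1 - t) ^+ N) A.
apply: le_trans (opnorm_mulmx_sum _ _ _) _; rewrite hX.
have -> : \sum_j s j *m (s j)^t* = rc (4 * l.+1%:R) *: A.
  rewrite /A scalerA -rcM mulfV ?rc1 ?scale1r // mulf_neq0 // pnatr_eq0 //.
rewrite -scalemxAr -scalemxAl -{2}(mfun_id Ap.1) -!mfunM.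
apply: le_trans (opnormZ _ _) _.
rewrite normc_rc ger0_norm; last by rewrite mulr_ge0 ?ler0n.
apply: ler_wpM2l; first by rewrite mulr_ge0 ?ler0n.
apply: (mfun_pcon_opnorm Ap); first by rewrite invr_ge0 ler0n.
move=> t /[dup] t01 /andP[t0 t1].
have u0 : 0 <= (1 - t) ^+ N by rewrite exprn_ge0 // subr_ge0.
have u1 : (1 - t) ^+ N <= 1 by rewrite exprn_ile1 ?subr_ge0 // lerBlDl lerDr.
rewrite ger0_norm; last by rewrite !mulr_ge0.
apply: le_trans (mul_expn_le N t01).
by rewrite ler_wpM2r // -[leRHS]mul1r ler_wpM2r.
Qed.

End Averages.

(** Ramps of the elements [b] from [separate_set] fix [k] up to about [d] near their points and are
    small where [k] is. Average their squares into [A] and put [lam = 1 - (1 - A)^N]: the power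
    makes [1 - lam] small on every ramp, while Bernoulli keeps [lam] below [N A]. *)
Lemma approximate_unit k d eta : B k -> 0 <= d -> 0 < eta ->
  exists2 lam, E lam & [/\ forall p, pcon (lam p),
    forall p, opnorm (k p) <= d -> opnorm (lam p) <= eta &
    forall p, opnorm (k p - lam p *m k p) <= d + eta].
Proof.
move=> Bk d0 eta0.
have [M M0 kM] := W_bounded Bk.1.
(* Room for an error [tau] from the cover and three errors of size [tau M]: two from replacing the
   ramp [s] by [s'], one from averaging. *)
pose tau := eta / (1 + 3 * M).
have M1 : 0 < 1 + 3 * M by rewrite ltr_pwDl // mulr_ge0.
have tau0 : 0 < tau by rewrite divr_gt0.
have [s [s_0 s_1 s_ramp]] := ramp_poly tau0.
pose G : set mxfun := [set f | exists b, [/\ E b, forall p, pcon (b p),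
  (forall p, opnorm (k p) <= d -> opnorm (b p) <= 2^-1) &
  f = fsub k (fun p => mfun (horner s) (b p) *m k p)]].
have sB := pairwise_in_star sW sE.
have GW : G `<=` W.
  move=> f [b [Eb bp _ ->]]; apply: starB => //; first exact: Bk.1.
  by apply: star_mfun_mul => // [|p|]; [exact: EW|exact: (bp p).1|exact: Bk.1].
(* The zero function is at most 0 everywhere, so this is a cover of all points. Its size [m] depends
   on [tau], and [N] below on [m]. *)
have [m [g [gG gcov]]] : exists m (g : 'I_m -> mxfun), (forall i, G (g i)) /\
    forall p, opnorm (0 : 'M[C]_(n p)) <= 0 -> exists i, opnorm (g i p) < d + tau.
  apply: (W_cover (k := fun=> 0)) => //; [exact: star0|exact: ltr_wpDl|].
  move=> p _; have [b Eb [bp bq bk bF]] := separate_set sE EW W_bounded W_cover Bk d0 p.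
  exists (fsub k (fun p => mfun (horner s) (b p) *m k p)); first by exists b.
  by rewrite /fsub bq //; apply: le_lt_trans bk _; rewrite ltrDl.
have [b bP] := choice gG.
pose N := Num.truncn (4 * m.+1%:R / tau ^+ 2).
have N0 : 4 * m.+1%:R / N.+1%:R <= tau ^+ 2.
  rewrite ler_pdivrMr ?ltr0n // [leRHS]mulrC -ler_pdivrMr ?exprn_gt0 //.
  by apply: ltW; apply: truncnS_gt.
(* [N] is now fixed, and [lam] may reach [N] times the ramp error where [k] is small; hence a
   second, finer ramp [s'], within [tau + tau'] of the first. *)
pose tau' := Num.min (Num.min tau 1) (eta / N.+1%:R).
have tau'0 : 0 < tau' by rewrite /tau' !lt_min tau0 ltr01 divr_gt0 ?ltr0n.
have tau'1 : tau' <= 1 by rewrite /tau' !ge_min lexx orbT.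
have tau'tau : tau' <= tau by rewrite /tau' !ge_min lexx.
have tau'eta : N%:R * tau' <= eta.
  have : tau' <= eta / N.+1%:R by rewrite /tau' ge_min lexx orbT.
  rewrite ler_pdivlMr ?ltr0n //; apply: le_trans.
  by rewrite mulrC ler_pM2l // ler_nat.
have [s' [s'_0 s'_1 s'_ramp]] := ramp_poly tau'0.
pose S (i : 'I_m) : mxfun := fun p => mfun (horner s') (b i p).
have ES i : E (S i).
  by have [Eb bp _ _] := bP i; apply: star_mfun => // p; exact: (bp p).1.
have S2 p i : opnorm (S i p) <= 2.
  have [Eb bp _ _] := bP i; apply: ramp_bound (bp p) _ s'_ramp.
  by rewrite tau'1 ltW.
pose A : mxfun := fun p => rc (4 * m.+1%:R)^-1 *: \sum_i S i p *m (S i p)^t*.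
have EA : E A.
  apply: (starZ sE); apply: (star_sum (F := fun i => fmul (S i) (fadj (S i)))) => //.
  by move=> i; apply: starM => //; apply: starJ.
have Ap p : pcon (A p) by apply: average_pcon.
pose q : {poly R} := 1 - (1 - 'X) ^+ N.
have qE : horner q = fun t => 1 - (1 - t) ^+ N.
  by apply/funext => t; rewrite /q !(hornerE, horner_exp).
exists (fun p => mfun (horner q) (A p)).
  apply: star_mfun => // [p|]; first exact: (Ap p).1.
  by rewrite qE subr0 expr1n subrr.
rewrite qE; split=> [p|p kp|p].
- apply: mfun_pcon; first exact: (Ap p).1.
  move=> t /(Ap p).2 /andP[t0 t1].
  by rewrite subr_ge0 exprn_ile1 ?subr_ge0 ?lerBlDl ?lerDr ?exprn_ge0 ?subr_ge0.
- have Atau : opnorm (A p) <= tau'.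
    have Sp i : opnorm (S i p) <= tau'.
      have [Eb bp bF _] := bP i; apply: ramp_opnorm (bp p) (ltW _) (bF p kp) s'_ramp.
      exact: tau'0.
    apply: le_trans (average_opnorm_le (ltW tau'0) Sp) _.
    rewrite expr2 mulrA -[leRHS]mul1r ler_pM2r //.
    have h4 : 4^-1 <= 1 :> R by rewrite invf_le1 ?ltr0n // ler1n.
    by rewrite mulr_ile1 ?invr_ge0 ?ler0n ?(ltW tau'0).
  apply: mfun_opnorm => //; [exact: (Ap p).1|exact: ltW|].
  move=> t st; have t01 := (Ap p).2 t st.
  have tt := le_trans (le_trans (ler_norm t) (spec_opnorm st)) Atau.
  have u1 : (1 - t) ^+ N <= 1.
    by case/andP: t01 => t0 t1; rewrite exprn_ile1 ?subr_ge0 ?lerBlDl ?lerDr.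
  rewrite ger0_norm ?subr_ge0 //.
  apply: le_trans (bernoulli N t01) _; apply: le_trans tau'eta.
  by rewrite ler_wpM2l ?ler0n.
- have [i gi] := gcov p (eq_ind_r (fun x => x <= 0) (lexx 0) (opnorm0 _ _)).
  have [Eb bp bF gE] := bP i.
  rewrite sub1mxM mfun_1sub subKr.
  set X := mfun _ _.
  have Xle : opnorm X <= 1.
    apply: mfun_pcon_opnorm (Ap p) ler01 _ => t /andP[t0 t1].
    by rewrite ger0_norm ?exprn_ge0 ?subr_ge0 // exprn_ile1 ?subr_ge0 // lerBlDl lerDr.
  have -> : X *m k p = X *m ((k p - mfun (horner s) (b i p) *m k p) +
      (mfun (horner s) (b i p) - S i p) *m k p) + X *m S i p *m k p.
    by rewrite mulmxBl addrA subrK -[X *m S i p *m k p]mulmxA -mulmxDr subrK.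
  have h1 : opnorm (X *m S i p) <= tau.
    rewrite -ler_sqr ?nnegrE ?opnorm_ge0 ?(ltW tau0) //.
    apply: le_trans N0; exact: average_complement_opnorm.
  have h2 := ramp_dist_opnorm (bp p) (ltW tau0) (ltW tau'0) s_ramp s'_ramp.
  rewrite gE /fsub in gi.
  have h3 := opnormM_le Xle (le_trans (opnormD _ _) (lerD (ltW gi) (opnormM_le h2 (kM p)))).
  have h4 := opnormM_le h1 (kM p).
  apply: le_trans (opnormD _ _) _; apply: le_trans (lerD h3 h4) _.
  have -> : eta = tau * (1 + 3 * M) by rewrite divfK // gt_eqF.
  have -> : 1 * (d + tau + (tau + tau') * M) + tau * M =
    d + tau + tau * M + tau * M + tau' * M by ring.
  have -> : d + tau * (1 + 3 * M) = d + tau + tau * M + tau * M + tau * M by ring.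
  by rewrite lerD2l ler_wpM2r.
Qed.

End Density.

(** * Gluing *)

Section Gluing.
Variables (R : realType) (P : Type) (n : P -> nat).
Local Notation C := (Cplx R).
Local Notation mxfun := (mxfun R n).
Variables W E : set mxfun.
Hypotheses (sW : star_closed W) (sE : star_closed E) (EW : E `<=` W).
Hypothesis W_bounded : forall f, W f -> fbounded f.
Hypothesis W_cover : finite_subcovers W.
Local Notation B := (pairwise_in W E).

(** * Flags of approximate units *)

Section Flag.
Variables (c1 c2 : mxfun) (F : set P) (M r e : R).
Hypotheses (Bc1 : B c1) (Bc2 : B c2).
Hypotheses (c1M : forall p, opnorm (c1 p) <= M) (c2M : forall p, opnorm (c2 p) <= M).
Hypotheses (M0 : 0 <= M) (r0 : 0 <= r) (e0 : 0 < e) (e1 : e <= 1).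
Hypothesis er : (1 + 3 * (1 + M) ^+ 2) * e <= r ^+ 2.

Definition flag_member (lam : mxfun) : Prop := [/\ E lam, forall p, pcon (lam p) &
  forall p, F p -> opnorm (lam p) <= e].

Definition flag_next (lam lam' : mxfun) : Prop := forall p,
  [/\ opnorm ((1%:M - lam' p) *m lam p) <= r,
      opnorm ((1%:M - lam' p) *m (c1 p *m lam p)) <= r &
      opnorm ((1%:M - lam' p) *m ((c2 p)^t* *m lam p)) <= r].

(** One approximate unit for [K], the sum of [a a^*] over [lam], [c1 lam] and [c2^* lam], serves all
    three, since [opnorm_mulmx_sum] dominates each of them by [K]. *)
Lemma flag_step lam : flag_member lam ->
  exists2 lam', flag_member lam' & flag_next lam lam'.
Proof.
move=> [Elam lamp lamF].
have sB := pairwise_in_star sW sE.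
have Blam : B lam by apply: pairwise_in_sub.
pose a (i : 'I_3) : mxfun :=
  match val i with 0 => lam | 1 => fmul c1 lam | _ => fmul (fadj c2) lam end.
have Ba i : B (a i).
  rewrite /a; case: (val i) => [|[|j]]; first exact: Blam.
    exact: (starM sB).
  by apply: (starM sB) => //; apply: (starJ sB).
pose K : mxfun := fun p => \sum_i a i p *m (a i p)^t*.
have BK : B K.
  apply: (star_sum (F := fun i => fmul (a i) (fadj (a i)))) => // i.
  by apply: (starM sB) => //; apply: (starJ sB).
(* On [F] each [a i] is at most [(1 + M) e], so [K] is at most [d e <= d]. *)
pose d := 3 * (1 + M) ^+ 2 * e.
have d0 : 0 <= d.
  by apply: mulr_ge0 (ltW e0); apply: mulr_ge0 (sqr_ge0 _); apply: ler0n.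
have M10 : 0 <= 1 + M by rewrite addr_ge0.
have KF p : F p -> opnorm (K p) <= d.
  move=> Fp; have lame := lamF p Fp.
  have aF i : opnorm (a i p) <= (1 + M) * e.
    have le_M : M <= 1 + M by rewrite lerDr.
    have eM : M * e <= (1 + M) * e by apply: ler_wpM2r (ltW e0) _ _ le_M.
    rewrite /a; case: (val i) => [|[|j]].
    - apply: le_trans lame _; rewrite -[leLHS]mul1r; apply: ler_wpM2r (ltW e0) _ _ _.
      by rewrite lerDl.
    - exact: le_trans (opnormM_le (c1M p) lame) eM.
    - apply: le_trans (opnormM_le _ lame) eM; rewrite opnorm_adj; exact: c2M.
  apply: le_trans (opnorm_sum _ _ _) _.
  apply: (@le_trans _ _ (\sum_(i < 3) ((1 + M) * e) ^+ 2)).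
    apply: ler_sum => i _; rewrite opnorm_CstarE.
    by rewrite lerXn2r ?nnegrE ?opnorm_ge0 ?(mulr_ge0 M10 (ltW e0)).
  rewrite sumr_const card_ord -[leLHS]mulr_natl.
  have -> : 3 * ((1 + M) * e) ^+ 2 = d * e by rewrite /d; ring.
  by rewrite -[leRHS]mulr1 ler_wpM2l.
have [lam' Elam' [lamp' lamF' lamK]] :=
  approximate_unit sW sE EW W_bounded W_cover BK d0 e0.
exists lam'.
  by split; [exact: Elam'|exact: lamp'|move=> p /KF; exact: lamF'].
move=> p; pose X : 'M[C]_(n p) := 1%:M - lam' p.
have X1 : opnorm X <= 1 by apply: pcon_1sub_opnorm.
have ar i : opnorm (X *m a i p) <= r.
  rewrite -ler_sqr ?nnegrE ?opnorm_ge0 //.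
  apply: le_trans (opnorm_mulmx_sum X (fun i => a i p) i) _.
  have XK : opnorm (X *m K p) <= d + e by rewrite -sub1mxM; apply: lamK.
  have X1' : opnorm (X^t*) <= 1 by rewrite opnorm_adj.
  apply: le_trans (opnormM_le XK X1') _; apply: le_trans er.
  have -> : (1 + 3 * (1 + M) ^+ 2) * e = (d + e) * 1 by rewrite /d; ring.
  exact: lexx.
split; [exact: (ar ord0)|exact: (ar (lift ord0 ord0))|exact: (ar ord_max)].
Qed.

Lemma flag_exists lam0 : flag_member lam0 -> exists L : nat -> mxfun,
  [/\ L 0%N = lam0, forall j, flag_member (L j) & forall j, flag_next (L j) (L j.+1)].
Proof.
move=> m0.
have step (l : {lam | flag_member lam}) :
    exists l' : {lam | flag_member lam}, flag_next (sval l) (sval l').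
  have [lam' lm' nx] := flag_step (svalP l); by exists (exist _ lam' lm').
have [next nextP] := choice step.
exists (fun j => sval (iter j next (exist _ lam0 m0))).
by split; [|move=> j; exact: svalP|move=> j; exact: nextP].
Qed.

End Flag.

(** Put [g = f1 + avg (f2 - f1)], with [avg] the mean of odd members of a flag that starts at an
    approximate unit [lam0] for [w = u - f1]. Where [w] is at most [eps], every flag member is small
    and [g] is near [f1]. Where [u - f2] is at most [eps], [u - g] is nearly the mean of
    [(1 - L) c1 + L c2], with [c1 = (1 - lam0) w] almost bounded by [eps] everywhere. *)
Lemma glue u f1 f2 eps eta : B u -> E f1 -> E f2 -> 0 <= eps -> 0 < eta ->
  exists2 g, E g & forall p,
    opnorm (u p - f1 p) <= eps \/ opnorm (u p - f2 p) <= eps ->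
    opnorm (u p - g p) <= eps + eta.
Proof.
move=> Bu Ef1 Ef2 eps0 eta0.
have sB := pairwise_in_star sW sE.
have BE f : E f -> B f by apply: pairwise_in_sub.
pose w := fsub u f1; pose c2 := fsub u f2; pose m := fsub f2 f1.
have Bw : B w by apply: starB => //; apply: BE.
have Bc2 : B c2 by apply: starB => //; apply: BE.
have Em : E m by apply: starB.
have [M1 M10 wM] := W_bounded Bw.1.
have [M2 M20 c2M] := W_bounded Bc2.1.
have [M3 M30 mM] := W_bounded (EW Em).
pose M := M1 + M2.
have M0 : 0 <= M by apply: addr_ge0.
have M1M : M1 <= M by rewrite lerDl.
have M2M : M2 <= M by rewrite lerDr.
pose t := eta / 4.
have t0 : 0 < t by rewrite divr_gt0.
pose D := eps + t.
have D0 : 0 <= D by rewrite addr_ge0 // ltW.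
(* The parameters are fixed in the order [N], [r], [e]. [N] and [r] make each term under the root in
   [flag_average_le], taken with the bound [D], at most half of [(N t)^2]; the second entry of [r]
   bounds the drift [(1 - L j) lam0 w]. *)
pose N := (Num.truncn (8 * D ^+ 2 / t ^+ 2)).+1.
have N_gt0 : 0 < N%:R :> R by rewrite ltr0n.
have N_neq0 : N%:R != 0 :> R by rewrite pnatr_eq0.
have ND : 8 * D ^+ 2 <= t ^+ 2 * N%:R.
  rewrite -ler_pdivrMl ?exprn_gt0 // mulrC; apply: ltW; exact: truncnS_gt.
pose Z := (1 + 2 * D) * (2 * D) * (N.*2)%:R.
have Z0 : 0 <= Z by rewrite !mulr_ge0 ?ler0n // addr_ge0 // mulr_ge0.
pose r := Num.min (t ^+ 2 / (2 * (Z + 1))) (t / ((N.*2)%:R * M1 + 1)).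
have Z1 : 0 < 2 * (Z + 1) by rewrite mulr_gt0 // ltr_wpDl.
have NM1 : 0 < (N.*2)%:R * M1 + 1 by rewrite ltr_wpDl // mulr_ge0 ?ler0n.
have r0 : 0 < r by rewrite /r lt_min !divr_gt0 // exprn_gt0.
have rZ : 2 * (r * Z) <= t ^+ 2.
  have : r <= t ^+ 2 / (2 * (Z + 1)) by rewrite /r ge_min lexx.
  rewrite ler_pdivlMr //; apply: le_trans.
  have -> : r * (2 * (Z + 1)) = 2 * (r * Z) + 2 * r by ring.
  by rewrite lerDl mulr_ge0 // ltW.
have rN : (N.*2)%:R * r * M1 <= t.
  have : r <= t / ((N.*2)%:R * M1 + 1) by rewrite /r ge_min lexx orbT.
  rewrite ler_pdivlMr //; apply: le_trans.
  have -> : r * ((N.*2)%:R * M1 + 1) = (N.*2)%:R * r * M1 + r by ring.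
  by rewrite lerDl ltW.
have MM : 0 < 1 + 3 * (1 + M) ^+ 2 by rewrite ltr_wpDr // mulr_ge0 ?sqr_ge0.
pose e := Num.min (Num.min 1 t) (Num.min (r ^+ 2 / (1 + 3 * (1 + M) ^+ 2)) (t / (M3 + 1))).
have M31 : 0 < M3 + 1 by rewrite ltr_wpDl.
have e0 : 0 < e by rewrite /e !lt_min ltr01 t0 !divr_gt0 // exprn_gt0.
have e1 : e <= 1 by rewrite /e !ge_min lexx.
have et : e <= t by rewrite /e !ge_min lexx orbT.
have er : (1 + 3 * (1 + M) ^+ 2) * e <= r ^+ 2.
  have : e <= r ^+ 2 / (1 + 3 * (1 + M) ^+ 2) by rewrite /e !ge_min lexx !orbT.
  by rewrite ler_pdivlMr // mulrC.
have eM3 : e * M3 <= t.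
  have : e <= t / (M3 + 1) by rewrite /e !ge_min lexx !orbT.
  by rewrite ler_pdivlMr //; apply: le_trans; rewrite mulrDr mulr1 lerDl ltW.
have [lam0 Elam0 [lamp0 lamF0 lamw0]] :=
  approximate_unit sW sE EW W_bounded W_cover Bw eps0 e0.
pose c1 := fsub w (fmul lam0 w).
have c1E p : c1 p = (1%:M - lam0 p) *m w p by rewrite /c1 /fsub /fmul sub1mxM.
have Bc1 : B c1 by apply: starB => //; apply: starM => //; apply: BE.
have c1M p : opnorm (c1 p) <= M1.
  rewrite c1E -[M1]mul1r; exact: opnormM_le (pcon_1sub_opnorm (lamp0 p)) (wM p).
pose F : set P := [set p | opnorm (w p) <= eps].
have mem0 : flag_member F e lam0 by split.
have [L [L0 Lmem Lnext]] := flag_exists Bc1 Bc2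
  (fun p => le_trans (c1M p) M1M) (fun p => le_trans (c2M p) M2M)
  M0 (ltW r0) e0 e1 er mem0.
have Lp p j : pcon (L j p) by have [_ h _] := Lmem j.
pose avg : mxfun := fscale (rc N%:R^-1) (fun p => \sum_(i < N) L i.*2.+1 p).
have Ni0 : 0 <= N%:R^-1 :> R by rewrite invr_ge0 ler0n.
have Eavg : E avg.
  apply: (starZ sE); apply: (star_sum (F := fun i : 'I_N => L i.*2.+1)) => // i.
  by have [h _ _] := Lmem i.*2.+1.
exists (fadd f1 (fmul avg m)); first by apply: starD => //; apply: starM.
have avg_opnorm k (X : 'I_N -> 'M[C]_k) c : (forall i, opnorm (X i) <= c) ->
    opnorm (rc N%:R^-1 *: \sum_i X i) <= c.
  move=> Xc; apply: le_trans (opnormZ _ _) _; rewrite normc_rc ger0_norm //.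
  have h : opnorm (\sum_i X i) <= N%:R * c.
    apply: le_trans (opnorm_sum _ _ _) _; apply: (@le_trans _ _ (\sum_(i < N) c)).
      exact: ler_sum.
    by rewrite sumr_const card_ord mulr_natl; apply: lexx.
  apply: le_trans (ler_wpM2l Ni0 h) _.
  by rewrite mulKf ?gt_eqF //; apply: lexx.
move=> p.
have uE : u p - fadd f1 (fmul avg m) p = w p - avg p *m m p.
  by rewrite /fadd /fmul /w /fsub opprD addrA.
rewrite uE; case=> [wp|c2p].
  have avge : opnorm (avg p) <= e.
    by apply: avg_opnorm => i; have [_ _ h] := Lmem i.*2.+1; apply: h.
  apply: le_trans (opnormB _ _) _; apply: lerD => //.
  apply: le_trans (opnormM_le avge (mM p)) _; apply: le_trans eM3 _.
  by rewrite /t ler_pdivrMr ?ltr0n // ler_peMr ?ler1n ?(ltW eta0).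
(* Used for odd indices, which are positive, so that [L 0 = lam0] is strictly lower in the flag. *)
have far j : (0 < j)%N -> opnorm ((1%:M - L j p) *m lam0 p) <= j%:R * r.
  case: j => // j _; rewrite -L0.
  exact: (@flag_far_le _ _ (fun i => L i p) r (fun i => Lp p i)
    (fun i => let: And3 h _ _ := Lnext i p in h) 0 j).
pose Y i : 'M[C]_(n p) := (1%:M - L i p) *m c1 p + L i p *m c2 p.
have -> : w p - avg p *m m p =
    rc N%:R^-1 *: \sum_(i < N) Y i.*2.+1
    + rc N%:R^-1 *: \sum_(i < N) (1%:M - L i.*2.+1 p) *m lam0 p *m w p.
  (* Here [w = c1 + lam0 w] and [c2 = w - m]. *)
  have hY i : Y i + (1%:M - L i p) *m lam0 p *m w p = w p - L i p *m m p.
    rewrite /Y addrAC -mulmxA -mulmxDr c1E -mulmxDl subrK mul1mx.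
    have -> : c2 p = w p - m p by rewrite /c2 /w /m /fsub opprB addrA subrK.
    by rewrite (mulmxBl _ _ (w p)) mul1mx (mulmxBr _ (w p)) addrA subrK.
  rewrite -scalerDr -big_split /=.
  under eq_bigr => i _ do rewrite hY.
  rewrite sumrB scalerBr -mulmx_suml scalemxAl -/(avg p).
  have wN : w p *+ N = rc N%:R *: w p.
    by rewrite -scaler_nat; congr (_ *: _); apply/esym; apply: rmorph_nat.
  rewrite sumr_const card_ord wN scalerA -rcM (mulVf N_neq0) rc1.
  rewrite scale1r; congr +%R.
apply: le_trans (opnormD _ _) _.
have h2 : opnorm (rc N%:R^-1 *: \sum_(i < N) (1%:M - L i.*2.+1 p) *m lam0 p *m w p) <= t.
  apply: avg_opnorm => i; apply: le_trans (opnormM_le (far _ _) (wM p)) _ => //.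
  apply: le_trans rN; rewrite ler_wpM2r // ler_wpM2r ?(ltW r0) // ler_nat.
  by apply: ltnW; rewrite -doubleS leq_double; apply: ltn_ord.
have c1D : opnorm (c1 p) <= D.
  rewrite /c1 /fsub /fmul; apply: le_trans (lamw0 p) _.
  by rewrite lerD2l.
have c2D : opnorm (c2 p) <= D.
  by apply: le_trans c2p _; rewrite lerDl ltW.
(* The flag was built with the global bound [M], but at this point [c1 p] and [c2 p] are bounded by
   [D], and [D] is what the average inherits. *)
have h1 := @flag_average_le _ _ (fun i => L i p) (c1 p) (c2 p) r D (ltW r0) D0
  (fun i => Lp p i) (fun i => let: And3 h _ _ := Lnext i p in h) c1D c2D
  (fun i => let: And3 _ h _ := Lnext i p in h)
  (fun i => let: And3 _ _ h := Lnext i p in h) N.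
have h3 : opnorm (rc N%:R^-1 *: \sum_(i < N) Y i.*2.+1) <= D + t.
  apply: le_trans (opnormZ _ _) _; rewrite normc_rc ger0_norm //.
  rewrite ler_pdivrMl //; apply: le_trans h1 _; rewrite (mulrDr _ D t) lerD2l.
  rewrite -[leRHS]ger0_norm; last by rewrite mulr_ge0 ?ler0n // ltW.
  rewrite -sqrtr_sqr ler_wsqrtr //.
  have -> : r * (1 + 2 * D) * (2 * D) * (N.*2)%:R = r * Z by rewrite /Z; ring.
  have -> : N%:R * (2 * D) ^+ 2 = 2^-1 * N%:R * (8 * D ^+ 2) by field.
  have -> : N%:R ^+ 2 * (r * Z) = 2^-1 * N%:R ^+ 2 * (2 * (r * Z)) by field.
  have -> : (N%:R * t) ^+ 2 = 2^-1 * N%:R * (t ^+ 2 * N%:R)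
     + 2^-1 * N%:R ^+ 2 * t ^+ 2 by field.
  by rewrite lerD // ler_wpM2l // mulr_ge0 ?invr_ge0 ?ler0n ?exprn_ge0 ?ler0n.
apply: le_trans (lerD h3 h2) _.
have -> : eta = t + t + t + t by rewrite /t; field.
by rewrite /D -!addrA !lerD2l lerDl ltW.
Qed.

(** Each induction step spends half of the remaining [eta]. *)
Lemma glue_finite u m (g : 'I_m -> mxfun) eps eta : B u -> (forall i, E (g i)) ->
  0 <= eps -> 0 < eta ->
  exists2 v, E v & forall p, (exists i, opnorm (u p - g i p) <= eps) ->
    opnorm (u p - v p) <= eps + eta.
Proof.
move=> Bu; elim: m g eta => [|m IH] g eta Eg eps0 eta0.
  exists (fun=> 0); first exact: star0.
  move=> p [i _]; apply: False_ind; exact: notF (ltn_ord i).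
have eta2 : 0 < eta / 2 by rewrite divr_gt0.
have [v Ev hv] := IH (fun i => g (lift ord0 i)) _ (fun i => Eg _) eps0 eta2.
have eps2 : 0 <= eps + eta / 2 by rewrite addr_ge0 // ltW.
have [w Ew hw] := glue Bu (Eg ord0) Ev eps2 eta2.
exists w; first exact: Ew.
move=> p; case=> i; case: (unliftP ord0 i) => [j ->|->] gi.
  have -> : eps + eta = eps + eta / 2 + eta / 2 by rewrite -addrA -splitr.
  by apply: hw; right; apply: hv; exists j.
have -> : eps + eta = eps + eta / 2 + eta / 2 by rewrite -addrA -splitr.
apply: hw; left; apply: le_trans gi _.
by rewrite lerDl ltW.
Qed.

(** At each point some [v] in [E] equals [u]. Finitely many such [v] are [eps / 2]-close to [u] on
    sets that cover everything, and [glue_finite] joins them. *)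
Theorem pairwise_in_closure u eps : B u -> 0 < eps ->
  exists2 v, E v & forall p, opnorm (u p - v p) <= eps.
Proof.
move=> Bu eps0; have eps2 : 0 < eps / 2 by rewrite divr_gt0.
pose G : set mxfun := [set f | exists2 v, E v & f = fsub u v].
have [m [g [gG gcov]]] : exists m (g : 'I_m -> mxfun), (forall i, G (g i)) /\
    forall p, opnorm (0 : 'M[C]_(n p)) <= 0 -> exists i, opnorm (g i p) < eps / 2.
  apply: (W_cover (k := fun=> 0)) => //; first exact: star0.
    by move=> f [v Ev ->]; apply: starB => //; [exact: Bu.1|exact: EW].
  move=> p _; have [v Ev [vp _]] := Bu.2 p p.
  by exists (fsub u v); [exists v|rewrite /fsub vp subrr opnorm0].
have bE i : exists v, E v /\ g i = fsub u v by have [v Ev gv] := gG i; exists v.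
have [b bP] := choice bE.
have [v Ev hv] := glue_finite Bu (fun i => (bP i).1) (ltW eps2) eps2.
exists v => // p; rewrite [eps]splitr; apply: hv.
have [i gi] := gcov p (eq_ind_r (fun x => x <= 0) (lexx 0) (opnorm0 _ _)).
have [_ gE] := bP i; rewrite gE in gi.
by exists i; apply: ltW gi.
Qed.

End Gluing.

(** * Finite-dimensional subspaces *)

Section FiniteDimensionalClosed.
Variable R : realType.
Local Notation C := (Cplx R).
Local Notation normc := (@complex.ComplexField.Normc.normc R).

(** Choose rows in [V] of maximal rank; adjoining another vector of [V] cannot raise the rank. *)
Lemma linear_set_spanned N (V : set 'rV[C]_N) :
  exists k (M : 'M[C]_(k, N)), (forall i, V (row i M)) /\
    forall v, V v -> (v <= M)%MS.
Proof.
pose Q r := `[< exists k (M : 'M[C]_(k, N)), (forall i, V (row i M)) /\ \rank M = r >].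
have Q0 : exists r, Q r.
  by exists 0%N; apply/asboolP; exists 0%N, 0; rewrite mxrank0; split=> // -[].
have QN r : Q r -> (r <= N)%N.
  by move=> /asboolP [k [M [_ <-]]]; apply: rank_leq_col.
case: (ex_maxnP Q0 QN) => r /asboolP [k [M [MV Mr]]] rmax.
exists k, M; split=> // v Vv.
have : Q (\rank (col_mx M v)).
  apply/asboolP; exists (k + 1)%N, (col_mx M v); split=> // i.
  rewrite -(fintype.splitK i); case: (fintype.split i) => j /=.
    by rewrite rowKu.
  by rewrite rowKd row_id.
move=> /rmax; rewrite -Mr -addsmxE => le_rank.
have := (mxrank_leqif_sup (addsmxSl M v)).2.
rewrite eqn_leq (mxrankS (addsmxSl M v)) le_rank => /esym.
by apply: submx_trans; apply: addsmxSr.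
Qed.

(** The span is cut out by [cokermx M]. Each of these equations holds at [x] up to a fixed multiple
    of every positive [e], hence exactly. *)
Lemma linear_set_closed N (V : set 'rV[C]_N) (x : 'rV[C]_N) :
  V 0 -> (forall v w, V v -> V w -> V (v + w)) ->
  (forall a v, V v -> V (a *: v)) ->
  (forall e, 0 < e -> exists2 v, V v & forall j, normc (x 0 j - v 0 j) <= e) ->
  V x.
Proof.
move=> V0 VD VZ xV; have [k [M [MV VM]]] := linear_set_spanned V.
have /submxP [D ->] : (x <= M)%MS.
  rewrite submxE; apply/eqP/matrixP => i j; rewrite ord1 [RHS]mxE.
  set K := cokermx M; set y := (x *m K) 0 j.
  pose S := \sum_l normc (K l j).
  have S0 : 0 <= S by apply: sumr_ge0 => l _; apply: normc_ge0.
  have ye e : 0 < e -> normc y <= e * S.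
    move=> /xV [v Vv xv].
    have -> : y = \sum_l (x 0 l - v 0 l) * K l j.
      have vK : (v *m K) 0 j = 0.
        by have /eqP -> : v *m K == 0 by [rewrite -submxE VM]; rewrite mxE.
      have mE (z : 'rV[C]_N) : (z *m K) 0 j = \sum_l z 0 l * K l j by rewrite mxE.
      transitivity ((x *m K) 0 j - (v *m K) 0 j); first by rewrite vK subr0.
      by rewrite !mE -sumrB; apply: eq_bigr => l _; rewrite mulrBl.
    apply: le_trans (normc_sum _ _ _) _; rewrite mulr_sumr ler_sum // => l _.
    by rewrite normcM ler_wpM2r ?normc_ge0.
  have y0 : normc y <= 0.
    rewrite leNgt; apply/negP => yp.
    have e0 : 0 < normc y / (2 * (S + 1)) by rewrite divr_gt0 // mulr_gt0 // ltr_wpDl.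
    have := ye _ e0; rewrite mulrAC ler_pdivlMr ?mulr_gt0 ?ltr_wpDl // ler_pM2l //.
    by lra.
  suff : `|y| == 0 by rewrite normr_eq0 => /eqP.
  by rewrite norm_rc (_ : normc y = 0) //; apply/eqP; rewrite eq_le y0 normc_ge0.
rewrite mulmx_sum_row; elim/big_ind: _ => // i _.
exact: VZ.
Qed.

(** Encodes pairs of values as row vectors for [linear_set_closed]: values at two points that are
    approximated arbitrarily well are attained. *)
Lemma pair_closed (m n : nat) (I : Type) (E : set I) (f : I -> 'M[C]_m) (g : I -> 'M[C]_n) a b :
  (exists2 i, E i & f i = 0 /\ g i = 0) ->
  (forall i j, E i -> E j -> exists2 l, E l & f l = f i + f j /\ g l = g i + g j) ->
  (forall c i, E i -> exists2 l, E l & f l = c *: f i /\ g l = c *: g i) ->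
  (forall e, 0 < e -> exists2 i, E i & opnorm (a - f i) <= e /\ opnorm (b - g i) <= e) ->
  exists2 i, E i & f i = a /\ g i = b.
Proof.
move=> h0 hD hZ hab.
pose enc (X : 'M[C]_m) (Y : 'M[C]_n) := row_mx (mxvec X) (mxvec Y).
have encD X X' Y Y' : enc (X + X') (Y + Y') = enc X Y + enc X' Y'.
  by rewrite /enc add_row_mx !linearD.
have encZ c X Y : enc (c *: X) (c *: Y) = c *: enc X Y.
  by rewrite /enc scale_row_mx !linearZ.
pose V := [set v | exists2 i, E i & v = enc (f i) (g i)].
suff [i Ei] : V (enc a b).
  move=> /eq_row_mx [/(can_inj mxvecK) ai /(can_inj mxvecK) bi].
  by exists i => //; rewrite ai bi.
apply: linear_set_closed.
- by have [i Ei [fi gi]] := h0; exists i => //; rewrite fi gi /enc !linear0 row_mx0.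
- move=> _ _ [i Ei ->] [j Ej ->]; have [l El [fl gl]] := hD i j Ei Ej.
  by exists l => //; rewrite fl gl encD.
- move=> c _ [i Ei ->]; have [l El [fl gl]] := hZ c i Ei.
  by exists l => //; rewrite fl gl encZ.
- move=> e e0; have [i Ei [ai bi]] := hab e e0.
  exists (enc (f i) (g i)); first by exists i.
  move=> j; have -> : enc a b 0 j - enc (f i) (g i) 0 j = enc (a - f i) (b - g i) 0 j.
    rewrite -(scaleN1r (f i)) -(scaleN1r (g i)) encD encZ scaleN1r.
    by rewrite [RHS]mxE [X in _ = _ + X]mxE.
  rewrite /enc -(fintype.splitK j); case: (fintype.split j) => l /=.
    rewrite row_mxEl; case/mxvec_indexP: l => p q; rewrite mxvecE.
    exact: le_trans (opnorm_entry _ _ _) ai.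
  rewrite row_mxEr; case/mxvec_indexP: l => p q; rewrite mxvecE.
  exact: le_trans (opnorm_entry _ _ _) bi.
Qed.

End FiniteDimensionalClosed.

(** * Functions on towers *)

Section TowerFunctions.
Variables (R : realType) (T : tower R).
Local Notation C := (Cplx R).
Local Notation normc := (@complex.ComplexField.Normc.normc R).
Local Notation tower_fun := (tower_fun T).

Lemma conform_opnorm m k (A : 'M[C]_m) : m = k ->
  opnorm (conform_mx (0 : 'M[C]_k) A) = opnorm A.
Proof. by case: _ /; rewrite conform_mx_id. Qed.

Lemma conformD m k (A B : 'M[C]_m) : m = k ->
  conform_mx (0 : 'M[C]_k) (A + B) = conform_mx 0 A + conform_mx 0 B.
Proof. by case: _ /; rewrite !conform_mx_id. Qed.

Lemma conformZ m k a (A : 'M[C]_m) : m = k ->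
  conform_mx (0 : 'M[C]_k) (a *: A) = a *: conform_mx 0 A.
Proof. by case: _ /; rewrite !conform_mx_id. Qed.

Lemma conformM m k (A B : 'M[C]_m) : m = k ->
  conform_mx (0 : 'M[C]_k) (A *m B) =
    conform_mx (0 : 'M[C]_k) A *m conform_mx (0 : 'M[C]_k) B.
Proof. by case: _ /; rewrite !conform_mx_id. Qed.

Lemma conformJ m k (A : 'M[C]_m) : m = k ->
  conform_mx (0 : 'M[C]_k) (A^t*) = (conform_mx (0 : 'M[C]_k) A)^t*.
Proof. by case: _ /; rewrite !conform_mx_id. Qed.

Lemma fiber_deg (f : tower_fun) x : fiber (deg x) f x = f x.
Proof. by rewrite /fiber conform_mx_id. Qed.

Lemma fiber_opnorm n (f : tower_fun) x : deg x = n -> opnorm (fiber n f x) = opnorm (f x).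
Proof. exact: conform_opnorm. Qed.

(** The algebraic part of [Cstar], which lets the core control norms on the whole tower. *)
Definition compatible (f : tower_fun) : Prop :=
  (forall (x : T) (U : 'M[C]_(deg x)), U \is unitarymx ->
     fiber (deg x) f (act U x) = U *m f x *m invmx U) /\
  (forall x y : T, fiber (deg x + deg y) f (oplus x y) = block_mx (f x) 0 0 (f y)).

Lemma Cstar_compatible f : Cstar f -> compatible f.
Proof. by case. Qed.

Lemma compatibleB f g : compatible f -> compatible g ->
  compatible (fun x => f x - g x).
Proof.
have fB n h k x : deg x = n ->
    fiber n (fun x => h x - k x : 'M[C]_(deg x)) x = fiber n h x - fiber n k x.
  move=> xn; rewrite /fiber -scaleN1r conformD // conformZ //.
  by rewrite scaleN1r.
move=> [fU fo] [gU go]; split=> [x U Uu|x y].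
  by rewrite fB ?deg_act // fU // gU // mulmxBr mulmxBl.
by rewrite fB ?deg_oplus // fo go opp_block_mx add_block_mx !oppr0 !addr0.
Qed.

(** Induction on the degree: a reducible point is unitarily equivalent to a sum of two points of
    smaller degree, since degrees are positive. The list depends on [x] alone and so serves every
    compatible [f]. *)
Lemma core_decomposition (x : T) : exists s : seq T,
  (forall z, z \in s -> core T z) /\
  forall f c, compatible f -> 0 <= c ->
    (forall z, z \in s -> opnorm (f z) <= c) -> opnorm (f x) <= c.
Proof.
have [n] := ubnP (deg x); elim: n x => // n IH x xn.
have [[a [b [V Vu Vx]]]|irr_x] := pselect (reducible x); last first.
  exists [:: x]; split=> [z|f c _ _ h]; first by rewrite inE => /eqP ->.
  by apply: h; rewrite inE.
have dab : deg x = (deg a + deg b)%N by rewrite -deg_oplus -Vx deg_act.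
have a0 := deg_gt0 a; have b0 := deg_gt0 b.
have [sa [saC saP]] : _ := IH a ltac:(lia).
have [sb [sbC sbP]] : _ := IH b ltac:(lia).
exists (sa ++ sb); split=> [z|f c fc c0 h].
  by rewrite mem_cat => /orP[/saC|/sbC].
apply: (@opnorm_conj_unitary_le _ _ V) => //.
rewrite -fc.1 // fiber_opnorm ?deg_act // Vx.
rewrite -(fiber_opnorm f (deg_oplus a b)) fc.2.
apply: opnorm_block_le => //.
  by apply: saP => // z zs; apply: h; rewrite mem_cat zs.
by apply: sbP => // z zs; apply: h; rewrite mem_cat zs orbT.
Qed.

(** The degree is locally constant ([near_deg]), so near [x] the fiber is [f y] itself and not the
    default 0. *)
Definition norm_continuous (f : tower_fun) : Prop := forall (x : T) (e : R), 0 < e ->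
  \forall y \near x, opnorm (fiber (deg x) f y - f x) < e.

Lemma near_deg (x : T) : \forall y \near x, deg y = deg x.
Proof.
have : nbhs (deg x) [set deg x] by apply: open_nbhs_nbhs; split => //; apply: discrete_open.
exact: deg_continuous.
Qed.

Lemma open_deg n : open [set x : T | deg x = n].
Proof.
rewrite openE => x /= <-; exact: near_deg.
Qed.

Lemma Cstar_norm_continuous f : Cstar f -> norm_continuous f.
Proof.
move=> [fc _ _ _] x e e0.
have cf : {for x, continuous (fiber (deg x) f)}.
  have h := fc (deg x); rewrite (continuous_open_subspace _ (open_deg _)) in h.
  by apply: h; rewrite inE.
(* Each of the [k^2] entries gets a share [d]; the [+ 1] keeps the divisor positive and the final
   inequality strict. *)
pose k := deg x; pose d := e / (k%:R * k%:R + 1).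
have k0 : 0 <= k%:R * k%:R :> R by rewrite mulr_ge0.
have d0 : 0 < d by rewrite divr_gt0 // ltr_wpDl.
have entry i j : \forall y \near x, normc ((fiber k f y - f x) i j) <= d.
  have cij : (fun y => fiber k f y i j) @ x --> fiber k f x i j.
    apply: (@continuous_comp _ _ _ (fiber k f) (fun M : 'M[C]_k => M i j) x) => //.
    exact: coord_continuous.
  have rd0 : 0 < rc d :> C by rewrite /rc ltcR.
  have h := cvg_ball cij rd0 (FF := nbhs_filter x).
  apply: filterS h => y; rewrite /ball /= norm_rc /rc ltcR => /ltW.
  by rewrite fiber_deg !mxE -normcN opprB.
have : \forall y \near x, forall ij : 'I_k * 'I_k,
    normc ((fiber k f y - f x) ij.1 ij.2) <= d.
  by apply: filter_forall => -[i j]; apply: entry.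
apply: filterS => y h; apply: le_lt_trans (opnorm_le_sum _) _.
apply: (@le_lt_trans _ _ (\sum_(i < k) \sum_(j < k) d)).
  by apply: ler_sum => i _; apply: ler_sum => j _; apply: (h (i, j)).
rewrite !sumr_const !card_ord -mulrnA -mulr_natl natrM.
rewrite /d mulrCA -[ltRHS]mulr1 ltr_pM2l // ltr_pdivrMr; last exact: ltr_wpDl.
by rewrite mul1r ltrDl.
Qed.

Lemma opnorm_lt_near f x c : norm_continuous f -> opnorm (f x) < c ->
  \forall y \near x, opnorm (f y) < c.
Proof.
move=> fc xc; have e0 : 0 < c - opnorm (f x) by rewrite subr_gt0.
apply: filterS (filterI (fc x _ e0) (near_deg x)) => y /= [h yx].
rewrite -(fiber_opnorm f yx).
have -> : fiber (deg x) f y = (fiber (deg x) f y - f x) + f x by rewrite subrK.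
by apply: le_lt_trans (opnormD _ _) _; rewrite -ltrBrDr.
Qed.

Lemma opnorm_gt_near f x c : norm_continuous f -> c < opnorm (f x) ->
  \forall y \near x, c < opnorm (f y).
Proof.
move=> fc xc; have e0 : 0 < opnorm (f x) - c by rewrite subr_gt0.
apply: filterS (filterI (fc x _ e0) (near_deg x)) => y /= [h yx].
rewrite -(fiber_opnorm f yx).
have := opnormB (fiber (deg x) f y) (fiber (deg x) f y - f x).
rewrite subKr => h2; have h3 := le_lt_trans h2 (ler_ltD (lexx _) h).
by move: h3; rewrite addrCA ltrDl subr_gt0.
Qed.

End TowerFunctions.

(** * Compactness and functions vanishing at infinity on the closure of the core *)

Lemma compact_cover_compact (X : topologicalType) (x0 : X) (A : set X) :
  compact A -> cover_compact A.
Proof.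
pose pX : ptopologicalType := HB.pack X (isPointed.Build X x0).
move=> Ac; have Ac' : @compact pX A by exact: Ac.
by rewrite (@compact_cover pX) in Ac'.
Qed.

Section DensityOnTowers.
Variables (R : realType) (T : tower R).
Local Notation C := (Cplx R).
Local Notation normc := (@complex.ComplexField.Normc.normc R).
Local Notation tower_fun := (tower_fun T).

Definition restrict P (r : P -> T) (f : tower_fun) : mxfun R (fun p => deg (r p)) :=
  fun p => f (r p).

Lemma star_closed_restrict P (r : P -> T) (A : set tower_fun) :
  star_closed (A : set (mxfun R (@deg R T))) -> star_closed (restrict r @` A).
Proof.
move=> sA; split.
- by exists (fun=> 0) => //; apply: (star0 sA).
- by move=> _ _ [f Af <-] [g Ag <-]; exists (fadd f g) => //; apply: (starD sA).
- by move=> a _ [f Af <-]; exists (fscale a f) => //; apply: (starZ sA).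
- by move=> _ _ [f Af <-] [g Ag <-]; exists (fmul f g) => //; apply: (starM sA).
- by move=> _ [f Af <-]; exists (fadj f) => //; apply: (starJ sA).
Qed.

Lemma star_subalgebra_closed A E : star_subalgebra A E ->
  star_closed (E : set (mxfun R (@deg R T))).
Proof. by case=> _ E0 ED EZ [EM EJ]. Qed.

Lemma norm_continuousD (f g : tower_fun) : norm_continuous f -> norm_continuous g ->
  norm_continuous (fadd f g : tower_fun).
Proof.
move=> fc gc x e e0; have e2 : 0 < e / 2 by rewrite divr_gt0.
apply: filterS (filterI (near_deg x) (filterI (fc x _ e2) (gc x _ e2))).
move=> y /= [yx [hf hg]]; rewrite /fiber /fadd conformD // opprD addrACA.
rewrite [e]splitr; exact: le_lt_trans (opnormD _ _) (ltrD hf hg).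
Qed.

Lemma mul_succ_le (a x : R) : 0 <= x -> a * x <= x * (a + 1).
Proof. by move=> x0; rewrite mulrDr mulr1 mulrC lerDl. Qed.

Lemma lt_div_mul (x y z : R) : 0 < z -> x < y / z -> x * z < y.
Proof. by move=> z0; rewrite ltr_pdivlMr. Qed.

Lemma le_div_mul (x y z : R) : 0 < z -> x <= y / z -> x * z <= y.
Proof. by move=> z0; rewrite ler_pdivlMr. Qed.

Lemma norm_continuousZ a (f : tower_fun) : norm_continuous f ->
  norm_continuous (fscale a f : tower_fun).
Proof.
move=> fc x e e0; have := fun X : 'M[C]_(deg x) => opnormZ a X.
move: (normc a) (normc_ge0 a) => c c0 aX.
have a0 : 0 < c + 1 by rewrite ltr_wpDl.
apply: filterS (filterI (near_deg x) (fc x _ (divr_gt0 e0 a0))).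
move=> y /= [yx]; rewrite /fiber /fscale conformZ // -scalerBr.
move=> /(lt_div_mul a0) hf.
exact: le_lt_trans (le_trans (aX _) (mul_succ_le _ (opnorm_ge0 _))) hf.
Qed.

Lemma norm_continuousM (f g : tower_fun) : norm_continuous f -> norm_continuous g ->
  norm_continuous (fmul f g : tower_fun).
Proof.
move=> fc gc x e e0.
pose S := opnorm (f x) + opnorm (g x) + 2.
have S0 : 0 < S by rewrite ltr_wpDl ?addr_ge0 ?opnorm_ge0.
pose d := Num.min 1 (e / S).
have d0 : 0 < d by rewrite lt_min ltr01 divr_gt0.
have d1 : d <= 1 by rewrite ge_min lexx.
have dS : d * S <= e by rewrite -ler_pdivlMr // ge_min lexx orbT.
apply: filterS (filterI (near_deg x) (filterI (fc x _ d0) (gc x _ d0))).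
move=> y /= [yx [hf hg]]; rewrite /fiber /fmul conformM // -!/(fiber _ _ _).
set u := fiber _ f y in hf *; set v := fiber _ g y in hg *.
have -> : u *m v - f x *m g x = (u - f x) *m v + f x *m (v - g x).
  by rewrite mulmxBl mulmxBr addrA subrK.
have vle : opnorm v <= opnorm (g x) + 1.
  have -> : v = (v - g x) + g x by rewrite subrK.
  rewrite addrC; apply: le_trans (opnormD _ _) _; apply: lerD (lexx _) _.
  exact: le_trans (ltW hg) d1.
have h1 := opnormM_le (ltW hf) vle.
have h2 := opnormM_le (lexx (opnorm (f x))) (ltW hg).
apply: le_lt_trans (opnormD _ _) _; apply: le_lt_trans (lerD h1 h2) _.
apply: lt_le_trans dS; rewrite [opnorm (f x) * d]mulrC -mulrDr ltr_pM2l //.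
by rewrite /S addrC addrA ltrD2l ltr1n.
Qed.

Lemma norm_continuousJ (f : tower_fun) : norm_continuous f ->
  norm_continuous (fadj f : tower_fun).
Proof.
move=> fc x e e0; apply: filterS (filterI (near_deg x) (fc x _ e0)).
move=> y /= [yx hf].
have -> : fiber (deg x) (fadj f : tower_fun) y - (f x)^t* = (fiber (deg x) f y - f x)^t*.
  by rewrite adjD adjN /fiber /fadj (conformJ _ yx).
by rewrite opnorm_adj.
Qed.

Lemma norm_continuous0 : norm_continuous ((fun=> 0) : tower_fun).
Proof.
move=> x e e0; apply: filterS (near_deg x) => y /= yx.
rewrite (_ : fiber _ _ _ = 0) ?subrr ?opnorm0 // /fiber.
by have := conformZ 0 (0 : 'M[C]_(deg y)) yx; rewrite !scale0r.
Qed.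

(** The analytic side of [Cstar0]: stable under the star operations and enough for boundedness and
    finite subcovers. *)
Definition C0_core : set tower_fun := [set f | [/\ norm_continuous f,
  exists2 M, 0 <= M & forall x, opnorm (f x) <= M &
  forall e : R, 0 < e -> exists K : set T, [/\ compact K, K `<=` closure (core T) &
    forall t, (closure (core T) `\` K) t -> opnorm (f t) <= e]]].

Lemma Cstar0_C0_core f : Cstar0 T f -> C0_core f.
Proof.
move=> [Cf f0]; split=> //; first exact: Cstar_norm_continuous.
have [_ _ _ [M hM]] := Cf.
exists (Num.max 0 M); first by rewrite le_max lexx.
by move=> x; rewrite le_max; apply/orP; right; apply: hM; exists x.
Qed.

Lemma C0_core_star : star_closed (C0_core : set (mxfun R (@deg R T))).
Proof.
split.
- split; first exact: norm_continuous0.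
    by exists 0 => // x; rewrite opnorm0.
  move=> e e0; exists set0; split=> //; first exact: compact0.
  by move=> t _; rewrite opnorm0 ltW.
- move=> f g [fc [M M0 fM] f0] [gc [N N0 gN] g0]; split.
  + exact: norm_continuousD.
  + exists (M + N); first exact: addr_ge0.
    by move=> x; apply: le_trans (opnormD _ _) (lerD (fM x) (gN x)).
  + move=> e e0; have e2 : 0 < e / 2 by rewrite divr_gt0.
    have [K [Kc KX Kf]] := f0 _ e2; have [L [Lc LX Lg]] := g0 _ e2.
    exists (K `|` L); split; first exact: compactU.
      by move=> t [/KX|/LX].
    move=> t [tX /not_orP [tK tL]]; rewrite [e]splitr.
    exact: le_trans (opnormD _ _) (lerD (Kf t (conj tX tK)) (Lg t (conj tX tL))).
- move=> a f [fc [M M0 fM] f0]; split.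
  + exact: norm_continuousZ.
  + exists (normc a * M); first by rewrite mulr_ge0 ?normc_ge0.
    by move=> x; apply: le_trans (opnormZ _ _) _; rewrite ler_wpM2l ?normc_ge0.
  + move=> e e0; have := fun t : T => opnormZ a (f t).
    move: (normc a) (normc_ge0 a) => c c0 aX.
    have a0 : 0 < c + 1 by rewrite ltr_wpDl.
    have [K [Kc KX Kf]] := f0 _ (divr_gt0 e0 a0); exists K; split=> // t /Kf.
    move=> /(le_div_mul a0) h.
    exact: le_trans (le_trans (aX t) (mul_succ_le _ (opnorm_ge0 _))) h.
- move=> f g [fc [M M0 fM] f0] [gc [N N0 gN] g0]; split.
  + exact: norm_continuousM.
  + exists (M * N); first exact: mulr_ge0.
    by move=> x; apply: opnormM_le (fM x) (gN x).
  + move=> e e0; have N1 : 0 < N + 1 by rewrite ltr_wpDl.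
    have [K [Kc KX Kf]] := f0 _ (divr_gt0 e0 N1); exists K; split=> // t tK.
    apply: le_trans (opnormM_le (Kf t tK) (gN t)) _.
    rewrite mulrAC (ler_pdivrMr _ _ N1) mulrC [leRHS]mulrC.
    by apply: ler_wpM2r (ltW e0) _ _ _; rewrite lerDl ler01.
- move=> f [fc [M M0 fM] f0]; split.
  + exact: norm_continuousJ.
  + by exists M => [|x]; [exact: M0|rewrite /fadj opnorm_adj; exact: fM].
  + move=> e /f0 [K [Kc KX Kf]]; exists K.
    by split; [exact: Kc|exact: KX|move=> t /Kf; rewrite /fadj opnorm_adj].
Qed.

(** One member [f0] of the family is below [c] outside a compact set [K]; within [K] the sublevel
    set of [k0] is compact and has an ordinary finite subcover. *)
Lemma C0_core_cover :
  finite_subcovers (restrict (@sval T (closure (core T))) @` C0_core).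
Proof.
move=> _ d G c [k0 [kc _ _] <-] GW c0 Gcov.
have [[p0 p0d]|none] := pselect (exists p, opnorm (restrict (@sval T (closure (core T))) k0 p) <= d);
  last first.
  exists 0%N, (fun=> fun=> 0); split=> [i|p pd]; first exact: False_ind _ (notF (ltn_ord i)).
  by case: none; exists p.
have [f0 Gf0 _] := Gcov _ p0d; have [F0 [F0c _ F0v] F0E] := GW _ Gf0.
have c2 : 0 < c / 2 by rewrite divr_gt0.
have [K [Kc KX KF0]] := F0v _ c2.
pose A := K `&` [set x | opnorm (k0 x) <= d].
have Ac : compact A.
  apply: compact_closedI => //; rewrite -openC openE => x /= /negP.
  rewrite -ltNge => /(opnorm_gt_near kc); apply: filterS => y.
  by rewrite ltNge => /negP.
have hF x : exists F, A x -> [/\ C0_core F, G (restrict (@sval T (closure (core T))) F) &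
    opnorm (F x) < c].
  have [[Kx kx]|Ax] := pselect (A x); last by exists (fun=> 0) => /Ax.
  have [f Gf fx] := Gcov (exist _ x (KX _ Kx)) kx.
  have [F CF FE] := GW _ Gf; exists F => _.
  by split; [exact: CF|rewrite FE; exact: Gf|rewrite -FE in fx; exact: fx].
have [h hP] := choice hF.
have := @compact_cover_compact T (sval p0) A Ac.
move=> /(_ T A (fun x => [set y | opnorm (h x y) < c])) [x Ax|x Ax|D' D'A AD'].
- have [[hc _ _] _ _] := hP x Ax.
  rewrite openE => y /= yc; exact: opnorm_lt_near.
- by exists x => //; have [_ _] := hP x Ax.
pose s := finmap.enum_fset D'.
(* Index 0 is kept for [f0], which handles the points outside [K]. *)
exists (size s).+1, (fun i => if val i is j.+1
  then restrict (@sval T (closure (core T))) (h (nth (sval p0) s j)) else f0).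
split=> [i|p pd].
  case: i => -[|j] /= ji //.
  have : nth (sval p0) s j \in s by apply: mem_nth.
  by move=> /D'A /set_mem /hP [].
have [pK|pK] := pselect (K (sval p)); last first.
  exists ord0 => /=; rewrite -F0E.
  have := KF0 _ (conj (svalP p) pK) => h1.
  by apply: le_lt_trans h1 _; rewrite ltr_pdivrMr // ltr_pMr // ltr1n.
have [x /= xD' xp] := AD' (sval p) (conj pK pd).
have xs : (index x s < size s)%N by rewrite index_mem.
exists (Ordinal (xs : ((index x s).+1 < (size s).+1)%N)) => /=.
by rewrite nth_index.
Qed.

End DensityOnTowers.

(** * From the core to the whole tower *)

Section StoneWeierstrass.
Variables (R : realType) (T : tower R).
Local Notation C := (Cplx R).
Local Notation tower_fun := (tower_fun T).

Lemma ordinal_subcovers m (n : 'I_m -> nat) :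
  finite_subcovers (setT : set (mxfun R n)).
Proof.
move=> k d G c _ _ c0 Gcov.
have [[p0 p0d]|none] := pselect (exists p, opnorm (k p) <= d); last first.
  exists 0%N, (fun=> fun=> 0); split=> [i|p pd]; first exact: False_ind _ (notF (ltn_ord i)).
  by case: none; exists p.
have [f0 Gf0 _] := Gcov _ p0d.
have hP p : exists f, G f /\ (opnorm (k p) <= d -> opnorm (f p) < c).
  have [pd|pd] := pselect (opnorm (k p) <= d); last by exists f0.
  by have [f Gf fp] := Gcov p pd; exists f.
have [h hh] := choice hP.
by exists m, h; split=> [i|p pd]; [exact: (hh i).1|exists p; exact: (hh p).2].
Qed.

Lemma ordinal_bounded m (n : 'I_m -> nat) (f : mxfun R n) : fbounded f.
Proof.
exists (\sum_i opnorm (f i)); first by apply: sumr_ge0 => i _; apply: opnorm_ge0.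
move=> p; rewrite (bigD1 p) //= lerDl; apply: sumr_ge0 => i _.
exact: opnorm_ge0.
Qed.

Variable E : set tower_fun.
Hypothesis E_subalgebra : star_subalgebra (Cstar0 T) E.

Let sE := star_subalgebra_closed E_subalgebra.
Let EC : E `<=` Cstar0 T. Proof. by case: E_subalgebra. Qed.

Lemma Cstar0_compatible f : Cstar0 T f -> compatible f.
Proof. by case=> /Cstar_compatible. Qed.

Section Closure.
Variable u : tower_fun.
Hypothesis u_C : Cstar0 T u.
Hypothesis u_pairs : forall x y : T,
  (core T `\` vanishing T) x -> (core T `\` vanishing T) y ->
  [set (v x, v y) | v in E] (u x, u y).

(** At points of the vanishing tower [u] and all of [E] are 0, so the two-point hypothesis extends
    to the entire core. *)
Lemma core_pairs x y : core T x -> core T y ->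
  exists2 v, E v & v x = u x /\ v y = u y.
Proof.
have vanish z f : vanishing T z -> E f -> f z = u z.
  by move=> zv /EC Cf; rewrite (zv _ Cf) (zv _ u_C).
move=> cx cy; have [vx|vx] := pselect (vanishing T x);
  have [vy|vy] := pselect (vanishing T y).
- exists (fun=> 0); first exact: (star0 sE).
  by split; [exact: (vanish x _ vx (star0 sE))|exact: (vanish y _ vy (star0 sE))].
- have [v Ev [vye _]] := u_pairs (conj cy vy) (conj cy vy).
  by exists v; [exact: Ev|split; [exact: vanish vx Ev|exact: vye]].
- have [v Ev [vxe _]] := u_pairs (conj cx vx) (conj cx vx).
  by exists v; [exact: Ev|split; [exact: vxe|exact: vanish vy Ev]].
- by have [v Ev [vxe vye]] := u_pairs (conj cx vx) (conj cy vy); exists v.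
Qed.

(** The density theorem on a finite set of core points, where all functions are bounded and covers
    are finite. *)
Lemma core_finite_approximation (s : seq T) e : (forall z, z \in s -> core T z) ->
  0 < e -> exists2 v, E v & forall z, z \in s -> opnorm (u z - v z) <= e.
Proof.
move=> sC e0; pose r (i : 'I_(size s)) := tnth (in_tuple s) i.
have rC i : core T (r i) by exact: sC _ (mem_tnth i (in_tuple s)).
have u_in : pairwise_in setT (restrict r @` E) (restrict r u).
  split=> // i j; have [v Ev [vi vj]] := core_pairs (rC i) (rC j).
  by exists (restrict r v); [exists v|split; [exact: vi|exact: vj]].
have sT : star_closed (setT : set (mxfun R (fun i => deg (r i)))) by split.
have [_ [v Ev <-] hv] := pairwise_in_closure sT (star_closed_restrict r sE)
  (@subsetT _ _) (fun f _ => ordinal_bounded f) (@ordinal_subcovers _ _) u_in e0.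
by exists v => // z /(tnthP (in_tuple s)) [i ->]; apply: hv.
Qed.

(** After decomposing [x] and [y] over the core, [core_finite_approximation] makes [u - v] small at
    both; finite dimension turns arbitrarily good approximation into equality. *)
Lemma exact_pairs x y : exists2 v, E v & v x = u x /\ v y = u y.
Proof.
have [sx [sxC sxP]] := core_decomposition x.
have [sy [syC syP]] := core_decomposition y.
apply: (pair_closed (f := fun v : tower_fun => v x) (g := fun v : tower_fun => v y)).
- by exists (fun=> 0); [exact: (star0 sE)|].
- by move=> f g Ef Eg; exists (fadd f g); [exact: (starD sE)|].
- by move=> c f Ef; exists (fscale c f); [exact: (starZ sE)|].
- move=> e e0; have sC z : z \in sx ++ sy -> core T z.
    by rewrite mem_cat => /orP[/sxC|/syC].
  have [v Ev hv] := core_finite_approximation sC e0; exists v; first exact: Ev.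
  have uv : compatible (fun z => u z - v z).
    by apply: compatibleB; apply: Cstar0_compatible; [exact: u_C|exact: EC].
  split; [apply: (sxP _ e uv (ltW e0))|apply: (syP _ e uv (ltW e0))] => z zs;
    by apply: hv; rewrite mem_cat zs ?orbT.
Qed.

(** Density on the closure of the core, with the two-point hypothesis from [exact_pairs];
    [core_decomposition] then carries the bound to the whole tower. *)
Lemma uniform_approximation e : 0 < e ->
  exists2 v, E v & forall x, opnorm (u x - v x) <= e.
Proof.
move=> e0; pose r := @sval T (closure (core T)).
pose W : set (mxfun R (fun p => deg (r p))) := restrict r @` @C0_core R T.
have sW : star_closed W by apply: star_closed_restrict; apply: C0_core_star.
have sEr : star_closed (restrict r @` E) by apply: star_closed_restrict.
have EW : restrict r @` E `<=` W.
  by move=> _ [v Ev <-]; exists v => //; apply/Cstar0_C0_core/EC.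
have Wb f : W f -> fbounded f.
  by case=> F [_ [M M0 FM] _] <-; exists M => // p; apply: FM.
have u_in : pairwise_in W (restrict r @` E) (restrict r u).
  split; first by exists u => //; apply: Cstar0_C0_core.
  move=> p q; have [v Ev [vp vq]] := exact_pairs (r p) (r q).
  by exists (restrict r v); [exists v|split; [exact: vp|exact: vq]].
have [_ [v Ev <-] hv] :=
  pairwise_in_closure sW sEr EW Wb (@C0_core_cover R T) u_in e0.
exists v; first exact: Ev.
move=> x; have [s [sC sP]] := core_decomposition x.
have uv : compatible (fun z => u z - v z).
  by apply: compatibleB; apply: Cstar0_compatible; [exact: u_C|exact: EC].
apply: (sP _ e uv (ltW e0)) => z /sC cz.
exact: (hv (exist _ z (subset_closure cz))).
Qed.

End Closure.

Lemma Cstar_norm_le (f : tower_fun) c : 0 <= c -> (forall x, opnorm (f x) <= c) ->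
  Cstar_norm f <= c.
Proof.
move=> c0 fc; have [[x]|none] := pselect (exists x : T, True).
  move=> _; apply: ge_sup; first by exists (opnorm (f x)); exists x.
  by move=> _ [y _ <-]; apply: fc.
(* On an empty tower the supremum is that of the empty set, which is 0 by convention. *)
have e : range (fun x : T => opnorm (f x)) = set0.
  by apply/seteqP; split=> // z [x]; case: none; exists x.
by rewrite /Cstar_norm e sup0.
Qed.

Lemma opnorm_le_Cstar_norm (f g : tower_fun) x : Cstar f -> Cstar g ->
  opnorm (f x - g x) <= Cstar_norm (fun x => f x - g x).
Proof.
move=> [_ _ _ [M fM]] [_ _ _ [N gN]]; apply: sup_upper_bound; last by exists x.
split; first by exists (opnorm (f x - g x)); exists x.
exists (M + N) => _ [y _ <-]; apply: le_trans (opnormB _ _) (lerD _ _).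
  by apply: fM; exists y.
by apply: gN; exists y.
Qed.

End StoneWeierstrass.

Theorem theorem4p15 (R : realType) (T : tower R)
    (T_mtower : mtower T) (T_elc : essentially_locally_compact T)
    (E : set (tower_fun T)) (E_subalgebra : star_subalgebra (Cstar0 T) E) :
  uniform_closure (Cstar0 T) E =
  [set u | Cstar0 T u /\
     forall x y : T, (core T `\` vanishing T) x -> (core T `\` vanishing T) y ->
       [set (v x, v y) | v in E] (u x, u y)].
Proof.
have [EC _ _ _ _] := E_subalgebra; have sE := star_subalgebra_closed E_subalgebra.
apply/seteqP; split=> u [Cu hu]; split=> //.
  move=> x y _ _.
  (* Uniform approximants are close at [x] and [y] simultaneously, so [pair_closed] yields an exact
     match. *)
  have [v Ev [vx vy]] : exists2 v, E v & v x = u x /\ v y = u y.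
    apply: (pair_closed (f := fun v : tower_fun T => v x)
      (g := fun v : tower_fun T => v y)).
    - by exists (fun=> 0); [exact: (star0 sE)|].
    - by move=> f g Ef Eg; exists (fadd f g); [exact: (starD sE)|].
    - by move=> c f Ef; exists (fscale c f); [exact: (starZ sE)|].
    - move=> e e0; have [v Ev uv] := hu e e0; exists v; first exact: Ev.
      have le z := le_trans (opnorm_le_Cstar_norm z Cu.1 (EC _ Ev).1) (ltW uv).
      by split; apply: le.
  by exists v; rewrite ?vx ?vy.
move=> e e0; have e2 : 0 < e / 2 by rewrite divr_gt0.
have [v Ev uv] := uniform_approximation E_subalgebra Cu hu e2.
exists v; first exact: Ev.
apply: le_lt_trans (Cstar_norm_le (ltW e2) uv) _.
by rewrite ltr_pdivrMr // ltr_pMr // ltr1n.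
Qed.
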